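(* Let $\mathcal{M}\subset\mathbb{R}^n$ be a compact Lipschitz manifold with dimension $d\ge j$, let $C\subset\mathbb{R}^j$, let $X\subset\mathbb{R}^m$, and for $x\in X$ let $$U(x):=\{u\in\mathcal{M}:\ c(u,x)\in C\},$$ where $c=(c_1,\dots,c_j)$ is $\mathbb{R}^j$-valued. Make the following assumptions: (i) $X$ is a convex subspace (i.e. a convex subset) of $\mathbb{R}^m$ and $U(x)\neq\emptyset$ for every $x\in X$. (ii) The map $c=(c_1,\dots,c_j)$ is Lipschitz continuous over $\mathcal{M}\times A$, where $X\subset A$ and $A$ is open in $\mathbb{R}^m$. (iii) For every $(u,x)$, with $u\in U(x)$ and $x\in X$, there exists $\pi\in\Pi(d,j)$ such that $$E(u,x,\pi):=\{P_\pi:\ P\in\partial_u c(u,x)\}$$ is invertible. Furthermore, let $$\sup_{x\in X,\ u\in U(x)}\ \sup_{\pi\in\Pi_{u,x}}\|E(u,x,\pi)^{-1}\|_\infty<\tau<\infty,$$ where $\Pi_{u,x}:=\{\pi\in\Pi(d,j):\ E(u,x,\pi)\text{ is invertible}\}$. Then $x\in X\mapsto U(x)$ is Lipschitz continuous with respect to the Hausdorff metric $d_H$ assigned over $Comp(\mathbb{R}^n)$, the space of all compact subsets of $\mathbb{R}^n$, and its Lipschitz constant can be estimated by a constant $L=L(\tau,\mathrm{Lip}(c),\mathrm{Lip}_{\mathcal{M}})$, where $$\mathrm{Lip}_{\mathcal{M}}:=\max\{\mathrm{Lip}(\psi^{-1})+\mathrm{Lip}(\psi):\ \psi\text{ is a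 chart on }\mathcal{M}\}.$$
   Context: Norms: for a matrix $O\in\mathbb{R}^{p\times q}$, $\|O\|:=\max_{x\in\mathbb{R}^q,\,|x|=1}|Ox|$. For a bounded set $V$ of real matrices of the same dimension, $\|V\|_\infty:=\sup_{v\in V}\|v\|$. A set $V$ of real square matrices of the same order is called invertible if every element of $V$ is invertible, and then $V^{-1}$ is the set of the inverses of the elements of $V$. $\mathrm{Lip}(\cdot)$ denotes the Lipschitz constant of a map. Hausdorff metric: for a separable metric space with metric $\rho$ (here $\mathbb{R}^n$), the Hausdorff metric over the space of all its compact subsets is $d_H(K_1,K_2)=\inf\{\varepsilon>0:\ K_1\subset K_2^\varepsilon\text{ and }K_2\subset K_1^\varepsilon\}$ for compact $K_1,K_2$, where $K^\varepsilon=\{y:\ \rho(y,K)<\varepsilon\}$. Lipschitz manifold: $\mathcal{M}\subset\mathbb{R}^n$ is a $d$-dimensional Lipschitz manifold if for every $u\in\mathcal{M}$ there exist an open neighborhood $W_u$ of $u$ in $\mathcal{M}$ and a homeomorphism $\psi_u:W_u\to V_u$, with $V_u$ an open subset of $\mathbb{R}^d$, such that $\psi_u$ and $\psi_u^{-1}$ are Lipschitz continuous; $(W_u,\psi_u)$ is called a chart. An atlas is a collection of charts whose domains cover $\mathcal{M}$. Every Lipschitz manifold is supposed to be endowed with an atlas, which is assumed finite if the manifold is compact; the charts in the definition of $\mathrm{Lip}_{\mathcal{M}}$ are those of this atlas. Generalized Jacobians: for $f:\Omega\to\mathbb{R}^p$, $\Omega\subset\mathbb{R}^q$ open, Lipschitz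 continuous near $x\in\Omega$, the generalized Jacobian $\partial f(x)$ is the convex hull of the set of all $P\in\mathbb{R}^{p\times q}$ of the form $P=\lim_{x_h\to x}\frac{\partial f}{\partial x}(x_h)$ with $f$ differentiable at $x_h$ for all $h$. For a locally Lipschitz continuous $f:\mathcal{N}\to\mathbb{R}^p$ on a Lipschitz manifold $\mathcal{N}$ with a given atlas and $w\in\mathcal{N}$, $$\partial f(w):=\mathrm{co}\Big(\bigcup_{(W,\psi)}\partial(f\circ\psi^{-1})(\psi(w))\Big),$$ where $\mathrm{co}$ is the convex hull and the union is over all charts $(W,\psi)$ of the atlas with $w\in W$. The product $\mathcal{M}\times A$ is viewed as a Lipschitz manifold of dimension $d+m$ whose charts are the products of the charts of $\mathcal{M}$ and the identity map over $A$. The generalized partial derivative of $c$ with respect to $u$ is $$\partial_u c(u,x):=\{P\in\mathbb{R}^{j\times d}:\ \exists\,Q\in\mathbb{R}^{j\times m}\text{ such that }[P,Q]\in\partial c(u,x)\}.$$ Submatrices: $\Pi(d,j)$ is the set of all multi-indexes $\pi=(i_1,\dots,i_j)$ with $1\le i_1<i_2<\dots<i_j\le d$. For $H\in\mathbb{R}^{j\times d}$ and $\pi\in\Pi(d,j)$, $H_\pi$ is the $j\times j$ submatrix of $H$ whose columns correspond to the indexes of $\pi$.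
   Formalization: Since U(x) need not be compact for an arbitrary set C (e.g. C an open interval), compactness of U(x) is asserted only for closed C; the Lipschitz estimate for d_H, given by the same infimum formula, is proved for every C. *)

(* Defs.v *)
From HB Require Import structures.
From mathcomp Require Import all_boot all_order all_algebra.
From mathcomp Require Import all_classical all_reals all_analysis.

Set Implicit Arguments.
Unset Strict Implicit.
Unset Printing Implicit Defensive.

Import Order.TTheory GRing.Theory Num.Theory.
Import numFieldNormedType.Exports.

Local Open Scope classical_set_scope.
Local Open Scope ring_scope.

(* Points of R^n are row vectors.  The library norm on 'rV[R]_n is the max
   norm: it is used here for topological notions only (open, compact,
   limits, differentiability); everything metric uses the Euclidean norm. *)
Definition enorm (R : realType) (n : nat) (x : 'rV[R]_n) : R :=
  Num.sqrt (\sum_(i < n) x ord0 i ^+ 2).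

(* With row vectors, O x reads x *m O^T. *)
Definition opnorm (R : realType) (p q : nat) (O : 'M[R]_(p, q)) : R :=
  sup [set enorm (x *m O^T) | x in [set x : 'rV[R]_q | enorm x = 1]].

(* Valued in \bar R, so that an unbounded set has norm +oo. *)
Definition setnorm (R : realType) (p q : nat) (V : set 'M[R]_(p, q)) : \bar R :=
  ereal_sup [set (opnorm v)%:E | v in V].

Definition mx_set_invertible (R : realType) (j : nat) (V : set 'M[R]_j) : Prop :=
  forall v, V v -> v \in unitmx.

Definition mx_set_inv (R : realType) (j : nat) (V : set 'M[R]_j) : set 'M[R]_j :=
  [set invmx v | v in V].

Definition lipschitz_with (R : realType) (p q : nat) (k : R)
    (D : set 'rV[R]_p) (f : 'rV[R]_p -> 'rV[R]_q) : Prop :=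
  forall x y, D x -> D y -> enorm (f x - f y) <= k * enorm (x - y).

Definition lipschitz_cont (R : realType) (p q : nat)
    (D : set 'rV[R]_p) (f : 'rV[R]_p -> 'rV[R]_q) : Prop :=
  exists k : R, lipschitz_with k D f.

(* Meaningful when f is Lipschitz on D: inf set0 = 0 by convention. *)
Definition Lip (R : realType) (p q : nat)
    (D : set 'rV[R]_p) (f : 'rV[R]_p -> 'rV[R]_q) : R :=
  inf [set k : R | 0 <= k /\ lipschitz_with k D f].

Definition pt_dist (R : realType) (n : nat) (y : 'rV[R]_n)
    (K : set 'rV[R]_n) : \bar R :=
  ereal_inf [set (enorm (y - z))%:E | z in K].

Definition enlarge (R : realType) (n : nat) (K : set 'rV[R]_n) (e : R) :
    set 'rV[R]_n :=
  [set y | (pt_dist y K < e%:E)%E].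

Definition hausdorff_dist (R : realType) (n : nat) (K1 K2 : set 'rV[R]_n) :
    \bar R :=
  ereal_inf [set e%:E | e in
    [set e : R | [/\ 0 < e, K1 `<=` enlarge K2 e & K2 `<=` enlarge K1 e]]].

(* A chart psi : W -> V; the two maps are total functions of which only the
   values on W and V respectively are meaningful. *)
Record chart (R : realType) (n d : nat) := Chart {
  chart_dom : set 'rV[R]_n ;
  chart_img : set 'rV[R]_d ;
  chart_map : 'rV[R]_n -> 'rV[R]_d ;
  chart_inv : 'rV[R]_d -> 'rV[R]_n }.

(* Being mutually inverse and Lipschitz, the two maps are homeomorphisms. *)
Definition is_lipschitz_chart (R : realType) (n d : nat) (M : set 'rV[R]_n)
    (psi : chart R n d) : Prop :=
  [/\ (exists2 O : set 'rV[R]_n, open O & chart_dom psi = M `&` O),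
      open (chart_img psi),
      (forall u, chart_dom psi u ->
         chart_img psi (chart_map psi u) /\
         chart_inv psi (chart_map psi u) = u),
      (forall v, chart_img psi v ->
         chart_dom psi (chart_inv psi v) /\
         chart_map psi (chart_inv psi v) = v) &
      lipschitz_cont (chart_dom psi) (chart_map psi) /\
      lipschitz_cont (chart_img psi) (chart_inv psi)].

Definition is_lipschitz_manifold (R : realType) (n d : nat) (M : set 'rV[R]_n)
    (atlas : set (chart R n d)) : Prop :=
  [/\ (forall psi, atlas psi -> is_lipschitz_chart M psi),
      (forall u, M u -> exists2 psi, atlas psi & chart_dom psi u) &
      (compact M -> finite_set atlas)].

(* The sup is a max, the atlas of a compact manifold being finite. *)
Definition LipM (R : realType) (n d : nat) (atlas : set (chart R n d)) : R :=
  sup [set Lip (chart_img psi) (chart_inv psi) +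
           Lip (chart_dom psi) (chart_map psi) | psi in atlas].

(* The product of two sets, as a subset of R^(n + m). *)
Definition row_prod (R : realType) (n m : nat) (M : set 'rV[R]_n)
    (A : set 'rV[R]_m) : set 'rV[R]_(n + m) :=
  [set w | M (lsubmx w) /\ A (rsubmx w)].

Definition prod_chart (R : realType) (n d m : nat) (psi : chart R n d)
    (A : set 'rV[R]_m) : chart R (n + m) (d + m) :=
  Chart (row_prod (chart_dom psi) A) (row_prod (chart_img psi) A)
    (fun w => row_mx (chart_map psi (lsubmx w)) (rsubmx w))
    (fun v => row_mx (chart_inv psi (lsubmx v)) (rsubmx v)).

Definition prod_atlas (R : realType) (n d m : nat)
    (atlas : set (chart R n d)) (A : set 'rV[R]_m) :
    set (chart R (n + m) (d + m)) :=
  [set prod_chart psi A | psi in atlas].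

Definition conv_hull (R : realType) (p q : nat) (S : set 'M[R]_(p, q)) :
    set 'M[R]_(p, q) :=
  smallest (fun B : set 'M[R]_(p, q) => convex_set B) S.

(* The library Jacobian 'J f x : 'M_(q, p) acts on row vectors from the right;
   the usual p x q Jacobian matrix is its transpose. *)
Definition gen_jacobian (R : realType) (p q : nat) (Omega : set 'rV[R]_q)
    (f : 'rV[R]_q -> 'rV[R]_p) (x : 'rV[R]_q) : set 'M[R]_(p, q) :=
  conv_hull [set P : 'M[R]_(p, q) | exists xs : nat -> 'rV[R]_q,
    [/\ (forall h, Omega (xs h) /\ differentiable f (xs h)),
        xs @ \oo --> x &
        (fun h => ('J f (xs h))^T) @ \oo --> P]].

Definition gen_jacobian_atlas (R : realType) (n d p : nat)
    (atlas : set (chart R n d)) (f : 'rV[R]_n -> 'rV[R]_p) (w : 'rV[R]_n) :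
    set 'M[R]_(p, d) :=
  conv_hull (\bigcup_(psi in [set psi | atlas psi /\ chart_dom psi w])
    gen_jacobian (chart_img psi) (f \o chart_inv psi) (chart_map psi w)).

Definition gen_partial_u (R : realType) (n d m j : nat)
    (atlas : set (chart R n d)) (A : set 'rV[R]_m)
    (c : 'rV[R]_(n + m) -> 'rV[R]_j) (u : 'rV[R]_n) (x : 'rV[R]_m) :
    set 'M[R]_(j, d) :=
  [set P | exists Q : 'M[R]_(j, m),
    gen_jacobian_atlas (prod_atlas atlas A) c (row_mx u x) (row_mx P Q)].

Definition multi_index (d j : nat) : set ('I_j -> 'I_d) :=
  [set pi : 'I_j -> 'I_d | forall a b : 'I_j, (a < b)%N -> (pi a < pi b)%N].

Definition E_set (R : realType) (n d m j : nat)
    (atlas : set (chart R n d)) (A : set 'rV[R]_m)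
    (c : 'rV[R]_(n + m) -> 'rV[R]_j) (u : 'rV[R]_n) (x : 'rV[R]_m)
    (pi : 'I_j -> 'I_d) : set 'M[R]_j :=
  [set colsub pi P | P in gen_partial_u atlas A c u x].

Definition Pi_set (R : realType) (n d m j : nat)
    (atlas : set (chart R n d)) (A : set 'rV[R]_m)
    (c : 'rV[R]_(n + m) -> 'rV[R]_j) (u : 'rV[R]_n) (x : 'rV[R]_m) :
    set ('I_j -> 'I_d) :=
  [set pi | multi_index pi /\ mx_set_invertible (E_set atlas A c u x pi)].

Definition U_set (R : realType) (n m j : nat) (M : set 'rV[R]_n)
    (C : set 'rV[R]_j) (c : 'rV[R]_(n + m) -> 'rV[R]_j) (x : 'rV[R]_m) :
    set 'rV[R]_n :=
  [set u | M u /\ C (c (row_mx u x))].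

(* Main.v *)
Require Import Defs.
From HB Require Import structures.
From mathcomp Require Import all_boot all_order all_algebra.
From mathcomp Require Import all_classical all_reals all_analysis.
From mathcomp Require Import measurable_realfun ring lra.
Import Order.TTheory GRing.Theory Num.Theory.
Import numFieldNormedType.Exports.
Local Open Scope classical_set_scope.
Local Open Scope ring_scope.

(* By compactness of M a point u of U(x) can be followed, along the segment
   from x to y and inside the level set of c through (u, x), up to a point of
   U(y), provided that near each of its points the level set can be followed at
   a fixed speed L. This local statement is Clarke's inverse function argument,
   in a chart and for the coordinates listed by pi. For a unit vector v the
   vectors v P_pi form a convex set of norms at least 1 / tau; hence some unit
   w satisfies v . (P_pi w) >= 1 / (2 tau) for all generalized Jacobians P, and
   by semicontinuity the same holds, with a smaller constant, at the points of
   differentiability near the base point. Integration along lines gives the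
   growth of v . c in the direction w, so that minimizing the residual of the
   equation plus a small multiple of the displacement solves the equation.

   Integration along lines rests on Rademacher's theorem, proved one coordinate
   at a time: a function with a first-order expansion in the first k
   coordinates also has one in the first k + 1 off a set that is null on every
   line parallel to the coordinate axis k. The union of such exceptional sets
   misses almost every point of almost every line of a given direction. *)

(** * Lipschitz functions of one real variable *)

Section lipschitz_primitive.
Variable R : realType.
Local Notation mu := (@lebesgue_measure R).
Local Open Scope ereal_scope.

(** Both measures are infima of sums of lengths over countable covers by half-open intervals, and
    the hypothesis compares these lengths interval by interval; hence the bound for arbitrary
    sets. *)
Lemma lebesgue_stieltjes_le (f : cumulative R R) (C : R) : (0 < C)%R ->
  (forall s t, s <= t -> f t - f s <= C * (t - s))%R ->
  forall A : set R, lebesgue_stieltjes_measure f A <= C%:E * mu A.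
Proof.
move=> Cp fC A; rewrite -lee_pdivrMl//.
apply: le_ereal_inf_tmp => _ [F [mF AF] <-].
rewrite lee_pdivrMl// -nneseriesZl//.
apply: (@le_trans _ _ (\sum_(k <oo) wlength f (F k))).
  by apply: ereal_inf_lbound; exists F.
apply: lee_nneseries => i _.
  by move=> _; apply: measure_ge0.
have [->|[[a b] /= ab ->]] := (ocitvP _).1 (mF i).
  by rewrite (wlength0 f) mule_ge0 ?measure_ge0 ?lee_fin ?ltW.
by rewrite !(wlength_itv_bnd _ _ _ (ltW ab)) -EFinM lee_fin fC// ltW.
Qed.

Lemma lebesgue_stieltjes_ocitv (f : cumulative R R) (a b : R) : (a <= b)%R ->
  lebesgue_stieltjes_measure f `]a, b]%classic = (f b - f a)%:E.
Proof.
move=> ab; rewrite /lebesgue_stieltjes_measure/= /measure_extension.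
by rewrite measurable_mu_extE/= ?wlength_itv_bnd//; exact: is_ocitv.
Qed.

(* phi + K id is the distribution function of a measure dominated by a multiple
   of the Lebesgue measure, to which the Radon-Nikodym theorem applies. *)
Lemma lipschitz_primitive (K : R) (phi : R -> R) (a b : R) : (0 < K)%R ->
  (forall x y, `|phi x - phi y| <= K * `|x - y|)%R -> (a < b)%R ->
  exists f : R -> R, [/\ mu.-integrable setT (EFin \o f),
    (forall t, 0 <= f t)%R,
    (forall x, a <= x <= b ->
       phi x - phi a + K * (x - a) = \int[mu]_(t in `]a, x]) f t)%R &
    {ae mu, forall t, (a < t < b)%R ->
       derivable phi t 1 /\ ((phi^`()%classic t) + K = f t)%R}].
Proof.
move=> K0 phiK ab.
pose Phi t := (phi t + K * t)%R.
have nd : nondecreasing Phi.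
  move=> x y xy; rewrite /Phi -subr_ge0.
  have := phiK x y; rewrite ler_norml => /andP[_].
  rewrite ler0_norm ?subr_le0//; lra.
have cphi : continuous phi.
  move=> x; apply/cvgrPdist_le => e e0; near=> y.
  rewrite (le_trans (phiK _ _))// -ler_pdivlMl//.
  near: y; apply: cvgr_dist_le; [exact: cvg_id|by rewrite mulr_gt0// invr_gt0].
have cPhi : continuous Phi.
  move=> x; apply: cvgD; first exact: cphi.
  by apply: cvgM; [exact: cvg_cst|exact: cvg_id].
have rc := right_continuousW cPhi.
pose F : cumulative R R := HB.pack Phi (isCumulative.Build R _ R Phi nd rc).
have mab : @measurable _ (measurableTypeR R) `]a, b]%classic by [].
have fin : lebesgue_stieltjes_measure F `]a, b]%classic < +oo.
  by rewrite lebesgue_stieltjes_ocitv ?ltW// ltry.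
(* Restriction to []a, b]] makes the measure finite, so that its density is integrable on the whole
   line. *)
pose nu := mfrestr mab fin.
have numu : nu `<< mu.
  apply/null_content_dominatesP => A mA muA0.
  apply/eqP; rewrite eq_le measure_ge0 andbT.
  rewrite (@le_trans _ _ (lebesgue_stieltjes_measure F A))//.
    rewrite /nu/= /mfrestr /mrestr le_measure// inE//; exact: measurableI.
  rewrite (le_trans (@lebesgue_stieltjes_le F (K + K) _ _ A)) ?muA0 ?mule0//.
    by rewrite addr_gt0.
  move=> s t st /=; rewrite /Phi.
  have := phiK t s; rewrite ler_norml => /andP[_].
  rewrite ger0_norm ?subr_ge0//; lra.
have [g [g0 gfin gint gE]] := radon_nikodym_sigma_finite numu.
pose f := fine \o g.
have fE : EFin \o f = g by apply/funext => x /=; rewrite fineK.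
have intf : mu.-integrable setT (EFin \o f) by rewrite fE.
have intfS (A : set R) : measurable A -> mu.-integrable A (EFin \o f).
  by move=> mA; exact: integrableS intf.
have PhiE x : (a <= x <= b)%R ->
    (phi x - phi a + K * (x - a) = \int[mu]_(t in `]a, x]) f t)%R.
  move=> /andP[ax xb]; rewrite /Rintegral.
  under eq_integral do rewrite /= fineK//.
  rewrite -gE//.
  rewrite /nu/= /mfrestr /mrestr setIidl; last first.
    by move=> t/=; rewrite !in_itv/= => /andP[-> /le_trans->].
  rewrite lebesgue_stieltjes_ocitv//= /Phi; lra.
exists f; split => //.
  by move=> t; rewrite fine_ge0.
have locf : locally_integrable [set: R] f.
  by apply: open_integrable_locally => //; exact: openT.
(* Lebesgue differentiation: the primitive [G] of [f] has derivative [f t] at almost every [t], and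
   inside the interval [phi] is [G] minus an affine function of slope [K]. *)
have := @FTC1 R f (BRight a) (fun y => intfS _ (measurable_itv _)) locf.
apply: filterS; first exact: (ae_filter_ringOfSetsType mu).
move=> t /= ft /andP[at_ tb].
have [] := ft at_.
set G := (fun x : R => _) => dG GE.
have nG : \near t, (G \- (fun x => K * (x - a) - phi a))%R t = phi t.
  near=> x; rewrite /= /G -PhiE; first by lra.
  by apply/andP; split; apply: ltW; near: x; [exact: lt_nbhsr|exact: lt_nbhsl].
have dL : is_derive t (1%R : R) (fun x => K * (x - a) - phi a)%R K.
  by apply: is_derive_eq; rewrite /GRing.scale/=; lra.
have dG1 : is_derive t (1%R : R) G (f t).
  by apply: DeriveDef => //; rewrite -derive1E.
have dGL : is_derive t (1%R : R) (G \- (fun x => K * (x - a) - phi a))%R (f t - K)%R.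
  by apply: is_deriveB.
have dphi : is_derive t (1%R : R) phi (f t - K)%R.
  exact: near_eq_is_derive nG dGL.
split; first exact: ex_derive.
by rewrite derive1E derive_val; lra.
Unshelve. all: by end_near. Qed.

End lipschitz_primitive.

Section lipschitz_ae.
Variable R : realType.
Local Notation mu := (@lebesgue_measure R).

Lemma lipschitz_ae_derivable (K : R) (phi : R -> R) : 0 < K ->
  (forall x y, `|phi x - phi y| <= K * `|x - y|) ->
  {ae mu, forall t, derivable phi t 1}.
Proof.
move=> K0 phiK.
have : {ae mu, forall t, forall n : nat, - n.+1%:R < t < n.+1%:R -> derivable phi t 1}.
  apply/ae_foralln => n.
  have /(lipschitz_primitive _ _ _ _ _ K0 phiK)[f [_ _ _]] : - n.+1%:R < n.+1%:R :> R.
    by rewrite (@lt_trans _ _ 0)// ?oppr_lt0.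
  apply: filterS; first exact: (ae_filter_ringOfSetsType mu).
  by move=> t /[apply] -[].
apply: filterS; first exact: (ae_filter_ringOfSetsType mu).
move=> t /(_ (Num.bound `|t|)); apply.
by rewrite -ltr_norml (lt_trans (archi_boundP (normr_ge0 t)))// ltr_nat.
Qed.

(** Adding [K] to the slope turns the increment into the integral of the nonnegative density of
    [lipschitz_primitive], which is almost everywhere at least [k + K]. *)
Lemma lipschitz_ae_derive_ge (K : R) (phi : R -> R) (a b k : R) : 0 < K ->
  (forall x y, `|phi x - phi y| <= K * `|x - y|) -> a < b ->
  {ae mu, forall t, a < t < b -> derivable phi t 1 -> k <= phi^`()%classic t} ->
  k * (b - a) <= phi b - phi a.
Proof.
move=> K0 phiK ab kphi.
have [f [intf f0 fE df]] := lipschitz_primitive _ _ _ _ _ K0 phiK ab.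
suff : (k + K) * (b - a) <= phi b - phi a + K * (b - a) by lra.
rewrite fE ?(ltW ab) ?lexx//.
have intfS : mu.-integrable `]a, b] (EFin \o f) by exact: integrableS intf.
(* The comparison of integrals below is the one for nonnegative integrands; a negative [k + K] is
   settled by [0 <= f] alone. *)
have [kK|kK] := ltP (k + K) 0.
  rewrite (@le_trans _ _ 0)//; first by rewrite pmulr_lle0 ?subr_gt0// ltW.
  exact: Rintegral_ge0.
rewrite -Rintegral_itv_bndo_bndc; last exact: integrableS intf.
rewrite /Rintegral -[leLHS]/(fine ((k + K) * (b - a))%:E).
have -> : ((k + K) * (b - a))%:E = (\int[mu]_(t in `]a, b[) (k + K)%:E)%E.
  by rewrite integral_cst//= lebesgue_measure_itv/= lte_fin ab -EFinB -EFinM.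
apply: fine_le.
- by rewrite integral_cst//= lebesgue_measure_itv/= lte_fin ab.
- by apply: integrable_fin_num => //; exact: integrableS intf.
apply: ae_ge0_le_integral => //.
- by move=> t _; rewrite lee_fin.
- apply: (measurable_funS measurableT) => //.
  exact: measurable_int intf.
move: df kphi; apply: filterS2; first exact: (ae_filter_ringOfSetsType mu).
move=> t /= dft kt; rewrite in_itv/= => tab.
have [dt <-] := dft tab.
by rewrite lee_fin lerD2r kt.
Qed.

(* A set is not porous at the points at which the distance to it is
   differentiable. *)
Lemma ae_nonporous (A : set R) :
  {ae mu, forall t, A t -> forall e, 0 < e -> exists2 d, 0 < d &
     forall s, `|s| < d -> exists2 a, A a & `|t + s - a| <= e * `|s|}.
Proof.
have [->|/set0P[a0 Aa0]] := eqVneq A set0; first by apply: aeW => t [].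
pose D (x : R) := [set `|x - a| | a in A].
pose phi x := inf (D x).
have D0 x : D x !=set0 by exists `|x - a0|, a0.
have Dlb x : has_lbound (D x) by exists 0 => _ [a _ <-].
have phiE x a : A a -> phi x <= `|x - a|.
  by move=> Aa; apply: ge_inf => //; exists a.
have phi0 x : 0 <= phi x by apply: lb_le_inf => // _ [a _ <-].
have phi_le x y : phi x <= phi y + `|x - y|.
  rewrite -lerBlDr; apply: lb_le_inf => // _ [a Aa <-].
  rewrite lerBlDr (le_trans (phiE _ _ Aa))// [leRHS]addrC.
  by rewrite (_ : x - a = (x - y) + (y - a)) ?ler_normD// addrA subrK.
have phiK x y : `|phi x - phi y| <= 1 * `|x - y|.
  rewrite mul1r ler_norml; apply/andP; split.
    by have := phi_le y x; rewrite distrC; lra.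
  by have := phi_le x y; lra.
have := lipschitz_ae_derivable _ _ ltr01 phiK.
apply: filterS; first exact: (ae_filter_ringOfSetsType mu).
move=> t dphi At e e0.
have phit : phi t = 0.
  by apply/eqP; rewrite eq_le phi0 andbT (le_trans (phiE _ _ At))// subrr normr0.
pose c := 'D_1 phi t.
have e4 : 0 < e / 4 by rewrite divr_gt0.
have : \forall h \near 0^', `|c - h^-1 *: (phi (h *: 1 + t) - phi t)| < e / 4.
  by move/cvgrPdist_lt : dphi; exact.
move=> [d /= d0 hd].
exists d => // s sd.
have [->|s0] := eqVneq s 0.
  by exists t => //; rewrite addr0 subrr normr0 mulr0.
have key h : h != 0 -> `|h| < d -> `|c * h - phi (t + h)| <= e / 4 * `|h|.
  move=> h0 hd1; have := hd h; rewrite /= sub0r normrN => /(_ hd1 h0).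
  rewrite phit subr0 /GRing.scale/= mulr1 (addrC h) => H.
  have -> : c * h - phi (t + h) = (c - h^-1 * phi (t + h)) * h.
    by rewrite mulrBl mulrAC mulVf// mul1r.
  by rewrite normrM ler_wpM2r// ltW.
have k1 := key _ s0 sd.
have k2 : `|c * (- s) - phi (t + - s)| <= e / 4 * `|- s|.
  by apply: key; rewrite ?oppr_eq0// normrN.
have p1 := phi0 (t + s); have p2 := phi0 (t + - s).
(* Adding the expansions at [s] and [- s] cancels the derivative [c]; since [phi (t - s)] is
   nonnegative, the bound on the sum passes to [phi (t + s)]. *)
have phis : phi (t + s) <= e / 2 * `|s|.
  move: k1 k2; rewrite normrN mulrN !ler_norml => /andP[k1 k1'] /andP[k2 k2'].
  lra.
have s1 : 0 < e / 2 * `|s| by rewrite mulr_gt0 ?divr_gt0// normr_gt0.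
have [_ [a Aa <-] ha] := inf_adherent s1 (conj (D0 (t + s)) (Dlb (t + s))).
exists a => //.
rewrite (le_trans (ltW ha))//; rewrite -/(phi (t + s)); lra.
Qed.

End lipschitz_ae.

(** * Sets that are null along parallel lines *)

Lemma ex_invS_lt (R : realType) (d : R) : 0 < d -> exists n, n.+1%:R^-1 < d.
Proof.
move=> d0; exists (Num.truncn d^-1).
by rewrite -[ltRHS]invrK ltf_pV2 ?posrE ?invr_gt0// truncnS_gt.
Qed.

Section lines.
Variables (R : realType) (q : nat).
Local Notation mu := (@lebesgue_measure R).
Local Notation V := 'rV[R]_q.
Local Notation T := (g_sigma_algebraType (@open V)).
Implicit Types (A B : set V) (e w p : V).

Definition borel A := measurable (A : set T).

Lemma open_borel A : open A -> borel A.
Proof. by move=> oA; exact: sub_sigma_algebra. Qed.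

Lemma closed_borel A : closed A -> borel A.
Proof.
move=> cA; rewrite /borel -(setCK A); apply: measurableC.
by apply: open_borel; exact: closed_openC.
Qed.

(** The building block of Aronszajn null sets: countable unions of Borel sets of this kind, for
    various [e], play the part of the null sets of R^q. *)
Definition null_along e A := forall x, mu [set t : R | A (x + t *: e)] = 0%E.

Definition line_map e (z : T * measurableTypeR R) : T := z.1 + z.2 *: e.

(** Measurability is for the product sigma-algebra, so an open set has to pull back to a countable
    union of measurable rectangles. *)
Lemma measurable_line_map e : measurable_fun setT (line_map e).
Proof.
apply: (measurability (@open V : set (set T))) => // _ [U oU <-].
rewrite setTI.
pose r (k : nat) : R := ratr (odflt 0%R (unpickle k)).
(* [x] is in [C k n] when the ball of radius 1 / (n + 1) around [x + r k *: e] lies in [U]; then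
   [x + t *: e] is in [U] for all [t] close enough to the rational [r k]. *)
pose C k n : set V := [set x | forall y, `|y - (x + r k *: e)| < n.+1%:R^-1 -> U y].
rewrite (_ : _ @^-1` _ = \bigcup_k \bigcup_n
   (C k n `*` [set t : R | `|t - r k| * `|e| < n.+1%:R^-1])); last first.
  apply/seteqP; split => [[x t] /=|[x t] /= [k _ [n _ [/= Cx tr]]]]; last first.
    apply: Cx; rewrite /line_map/= opprD addrACA subrr add0r -scalerBl.
    by rewrite normrZ.
  rewrite /line_map/= => Ux.
  have : nbhs (x + t *: e) U by exact: open_nbhs_nbhs.
  move=> /nbhs_ballP[d /= d0 dU].
  have d20 : 0 < d / 2 by rewrite divr_gt0.
  have [n nd] := @ex_invS_lt _ _ d20.
  have n0 : 0 < n.+1%:R^-1 :> R by rewrite invr_gt0.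
  have e1 : 0 < `|e| + 1 by rewrite ltr_wpDl.
  have h0 : 0 < n.+1%:R^-1 / (`|e| + 1) by rewrite divr_gt0.
  move hE : (n.+1%:R^-1 / (`|e| + 1)) h0 => h h0.
  have [s] := @rat_in_itvoo R (t - h) (t + h) ltac:(lra).
  rewrite in_itv/= => s_in.
  have rs : r (pickle s) = ratr s by rewrite /r pickleK.
  have ts : `|t - r (pickle s)| * `|e| < n.+1%:R^-1.
    have th : `|t - r (pickle s)| < n.+1%:R^-1 / (`|e| + 1).
      by rewrite hE rs ltr_norml; case/andP: s_in => ? ?; apply/andP; split; lra.
    rewrite (@le_lt_trans _ _ (`|t - r (pickle s)| * (`|e| + 1)))//.
      by rewrite ler_wpM2l// lerDl.
    by rewrite -ltr_pdivlMr.
  exists (pickle s) => //; exists n => //; split => //= y yx.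
  apply: dU; rewrite -ball_normE/=.
  have -> : x + t *: e - y = (t - r (pickle s)) *: e - (y - (x + r (pickle s) *: e)).
    by apply/rowP => i; rewrite !mxE; ring.
  rewrite (le_lt_trans (ler_normB _ _))// normrZ.
  by rewrite (splitr d) ltrD// (lt_trans _ nd).
apply: bigcupT_measurable => k; apply: bigcupT_measurable => n.
apply: measurableX.
  apply: closed_borel.
  rewrite -(setCK (C k n)); apply: open_closedC.
  rewrite (_ : ~` _ = \bigcup_(y in ~` U) [set x | `|x - (y - r k *: e)| < n.+1%:R^-1]).
    apply: bigcup_open => y _.
    rewrite (_ : mkset _ = ball (y - r k *: e) n.+1%:R^-1).
      exact: ball_open.
    by apply/seteqP; split => x; rewrite -ball_normE/= distrC.
  apply/seteqP; split => x /=.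
    move=> /existsNP[y /not_implyP[xy Uy]]; exists y => //=.
    rewrite distrC; congr (`|_| < _): xy.
    by apply/rowP => i; rewrite !mxE; ring.
  move=> [y Uy /= xy] /(_ y) h; apply: Uy; apply: h.
  rewrite distrC; congr (`|_| < _): xy.
  by apply/rowP => i; rewrite !mxE; ring.
apply: open_measurable.
apply: (@open_comp _ _ (fun t : R => `|t - r k| * `|e|) [set t | t < n.+1%:R^-1]).
  move=> t _; apply: cvgM; last exact: cvg_cst.
  by apply: cvg_norm; apply: cvgB; [exact: cvg_id|exact: cvg_cst].
exact: open_lt.
Qed.

Lemma borel_line_map e A : borel A ->
  measurable (line_map e @^-1` (A : set T)).
Proof.
move=> bA; rewrite -[X in measurable X]setTI.
by apply: measurable_line_map.
Qed.

Lemma line_xsection e A x :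
  xsection (line_map e @^-1` (A : set T)) x = [set t | A (x + t *: e)].
Proof. by apply/seteqP; split => t /=; rewrite /xsection/= inE. Qed.

Lemma line_ysection e A t :
  ysection (line_map e @^-1` (A : set T)) t = [set x | A (x + t *: e)].
Proof. by apply/seteqP; split => x /=; rewrite /ysection/= inE. Qed.

Lemma borel_shift e A t : borel A -> borel [set x | A (x + t *: e)].
Proof.
move=> bA; rewrite /borel -line_ysection.
by apply: measurable_ysection; apply: borel_line_map.
Qed.

Lemma measurable_line e A x : borel A ->
  measurable ([set t | A (x + t *: e)] : set (measurableTypeR R)).
Proof.
move=> bA; rewrite -line_xsection.
by apply: measurable_xsection; apply: borel_line_map.
Qed.

Lemma measurable_line_measure (Q : {sigma_finite_measure set (measurableTypeR R) -> \bar R}) e A :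
  borel A -> measurable_fun [set: T] (fun x => Q [set t | A (x + t *: e)]).
Proof.
move=> /(borel_line_map e) mA; have := measurable_fun_xsection Q mA.
by apply: eq_measurable_fun => x _ /=; rewrite line_xsection.
Qed.

Lemma measurable_shift_measure (P : probability T R) e A : borel A ->
  measurable_fun [set: measurableTypeR R] (fun t => P [set x | A (x + t *: e)]).
Proof.
move=> /(borel_line_map e) mA; have := measurable_fun_ysection P mA.
by apply: eq_measurable_fun => t _ /=; rewrite line_ysection.
Qed.

Lemma line_tonelli (P : probability T R)
    (Q : {sigma_finite_measure set (measurableTypeR R) -> \bar R}) e A : borel A ->
  (\int[P]_x Q [set t | A (x + t *: e)%R] = \int[Q]_t P [set x | A (x + t *: e)%R])%E.
Proof.
move=> /(borel_line_map e) mA; have := indic_fubini_tonelli P Q mA.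
rewrite indic_fubini_tonelli_FE// indic_fubini_tonelli_GE//.
under eq_integral do rewrite /= line_xsection.
by under [in RHS]eq_integral do rewrite /= line_ysection.
Qed.

Lemma null_along_shift e A w t : null_along e A ->
  null_along e [set x | A (x + t *: w)].
Proof.
move=> nA x; rewrite -(nA (x + t *: w)); congr (mu _).
by apply/seteqP; split => s /=; rewrite addrAC.
Qed.

(* The law of p + sum_i t_i e_i for independent t_i uniform on [0, d]. *)
Lemma ex_transversal_probability (es : seq V) p (r : R) : 0 < r ->
  exists P : probability T R,
    (forall A, borel A -> (forall x, `|x - p| <= (size es)%:R * r -> ~ A x) ->
       P A = 0%E) /\
    forall e A, e \in es -> borel A -> null_along e A -> P A = 0%E.
Proof.
move=> r0; elim: es => [|e es [P [supP nullP]]].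
  exists (dirac (p : T)); split => // A bA Ap.
  change ((\1_A p : R)%:E = 0%E); rewrite indicE memNset//.
  by apply: Ap; rewrite subrr normr0 mul0r.
pose d := r / (`|e| + 1).
have e1 : 0 < `|e| + 1 by rewrite ltr_wpDl.
have d0 : 0 < d by rewrite divr_gt0.
pose Q : probability (measurableTypeR R) R := uniform_prob d0.
pose X : {mfun (T * measurableTypeR R)%type >-> T} := HB.pack (line_map e)
  (isMeasurableFun.Build _ _ _ _ _ (measurable_line_map e)).
pose P' : probability T R := distribution (P \x Q)%E X.
have P'E A : borel A -> P' A = (\int[P]_x Q [set t | A (x + t *: e)%R])%E.
  move=> bA; rewrite /P'/= /distribution /pushforward/= /product_measure1.
  by apply: eq_integral => x _ /=; rewrite line_xsection.
have Qnull (S : set (measurableTypeR R)) : measurable S -> mu S = 0%E -> Q S = 0%E.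
  move=> mS S0; have /null_content_dominatesP := dominates_uniform_prob d0.
  exact.
exists P'; split => [A bA Ap|e' A].
  rewrite P'E// line_tonelli//.
  have f0 t : (0 <= P [set x | A (x + t *: e)%R])%E by exact: measure_ge0.
  under eq_integral do rewrite -(gee0_abs (f0 _)).
  apply/ae_eq_integral_abs => //; first exact: measurable_shift_measure.
  exists (~` `[0%R, d]); split; first exact: measurableC.
    rewrite /Q/= /uniform_prob integral_uniform_pdf integral0_eq// => t.
    by rewrite /= => -[].
  move=> t /= /not_implyP[_ Pt]; apply: contra_not Pt; rewrite in_itv/= => /andP[t0 td].
  apply: supP; first exact: borel_shift.
  move=> x xp; apply: Ap; rewrite (_ : _ - _ = (x - p) + t *: e); last first.
    by apply/rowP => i; rewrite !mxE; ring.
  rewrite (le_trans (ler_normD _ _))// -natr1 mulrDl mul1r lerD//.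
  rewrite normrZ (ger0_norm t0).
  rewrite (@le_trans _ _ (d * (`|e| + 1)))//; last by rewrite /d divfK// gt_eqF.
  by rewrite ler_pM// lerDl.
(* For the new direction the integral over [t] comes first and its sections are null; for an old one
   the order is exchanged, a translate of [A] being still null along [e']. *)
rewrite in_cons => /orP[/eqP ->|ees] bA nA.
  rewrite P'E// integral0_eq// => x _; apply: Qnull; first exact: measurable_line.
  exact: nA.
rewrite P'E// line_tonelli// integral0_eq// => t _.
by apply: (nullP e') => //; [exact: borel_shift|exact: null_along_shift].
Qed.

(** The probability above vanishes on all translates of all the [B i]; by Tonelli, for almost every
    [x], the line through [x] in the arbitrary direction [w] meets each of them in a null set.
    Almost every [x] is also in the ball around [p], which carries all the mass. *)
Lemma ex_transversal_line (es : seq V) (e : nat -> V) (B : nat -> set V)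
    p w (r l : R) : 0 < r ->
  (forall i, e i \in es) -> (forall i, borel (B i)) ->
  (forall i, null_along (e i) (B i)) ->
  exists2 x, `|x - p| <= r &
    forall i, mu (`[0%R, l] `&` [set t | B i (x + t *: w)]) = 0%E.
Proof.
move=> r0 ees bB nB.
pose d := r / (size es).+1%:R.
have d0 : 0 < d by rewrite divr_gt0.
have [P [supP nullP]] := @ex_transversal_probability es p d d0.
have mI : measurable (`[0%R, l]%classic : set (measurableTypeR R)) by [].
have fin : (mu `[0%R, l]%classic < +oo)%E.
  by rewrite lebesgue_measure_itv/=; case: ifP => _; rewrite ltey.
pose Q := mfrestr mI fin.
have QE S : Q S = mu (`[0%R, l] `&` S)%classic by rewrite /Q/= /mfrestr /mrestr setIC.
have ae0 : {ae P, forall x, forall i, Q [set t | B i (x + t *: w)] = 0%E}.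
  apply/ae_foralln => i.
  have : (\int[P]_x `|Q [set t | B i (x + t *: w)%R]| = 0)%E.
    under eq_integral do rewrite gee0_abs ?measure_ge0//.
    rewrite line_tonelli// integral0_eq// => t _.
    by apply: (nullP (e i)) => //; [exact: borel_shift|exact: null_along_shift].
  move/ae_eq_integral_abs => /(_ measurableT (measurable_line_measure _ _ _ (bB i))).
  by apply: filterS => x; exact.
have [N [mN PN0 subN]] := ae0.
pose F := [set x : V | r < `|x - p|].
have bF : borel F.
  rewrite -(setCK F) /borel; apply: measurableC; apply: closed_borel.
  rewrite (_ : ~` F = closed_ball_ Num.norm p r); first exact: closed_closed_ball_.
  by apply/seteqP; split => x /=; rewrite /closed_ball_/= /F/= distrC leNgt => /negP.
have PF0 : P F = 0%E.
  apply: supP => // x xp /=; apply/negP; rewrite -leNgt (le_trans xp)//.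
  by rewrite /d mulrCA ler_piMr ?(ltW r0)// ler_pdivrMr// mul1r ler_nat.
have [x xNF] : exists x, ~ (N `|` F) x.
  apply/existsNP => NF.
  have := probability_setT P.
  have -> : [set: T] = N `|` F by apply/seteqP; split.
  by rewrite measureU0// => P1; move: PN0; rewrite P1 => /eqP; rewrite onee_eq0.
exists x; first by rewrite leNgt; apply/negP => xF; apply: xNF; right.
move=> i; rewrite -QE.
suff H : forall i, Q [set t | B i (x + t *: w)] = 0%E by exact: H.
by apply: contrapT => xN; apply: xNF; left; apply: subN.
Qed.

End lines.

(** * Rademacher's theorem *)

Section maxnorm.
Variable R : realType.

Lemma lipschitz_continuous (U W : normedModType R) (K : R) (f : U -> W) :
  0 < K -> (forall x y, `|f x - f y| <= K * `|x - y|) -> continuous f.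
Proof.
move=> K0 fK x; apply/cvgrPdist_le => e e0; near=> y.
rewrite (le_trans (fK _ _))// -ler_pdivlMl//.
near: y; apply: cvgr_dist_le; [exact: cvg_id|by rewrite mulr_gt0// invr_gt0].
Unshelve. all: by end_near. Qed.

Lemma closed_le_fun (U : topologicalType) (f : U -> R) (c : R) :
  continuous f -> closed [set x | f x <= c].
Proof.
move=> cf; have := @closed_le R c; move: cf => /continuous_closedP; exact.
Qed.

Lemma le_mx_norm (m n : nat) (M : 'M[R]_(m, n)) i j : `|M i j| <= `|M|.
Proof.
rewrite [leRHS]/Num.norm /= mx_normrE.
by rewrite (le_bigmax _ (fun ij => `|M ij.1 ij.2|) (i, j)).
Qed.

Lemma mx_norm_le (m n : nat) (M : 'M[R]_(m, n)) c : 0 <= c ->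
  (forall i j, `|M i j| <= c) -> `|M| <= c.
Proof.
move=> c0 Mc; rewrite [leLHS]/Num.norm /= mx_normrE.
by apply/bigmax_leP; split => // -[i j] _; exact: Mc.
Qed.

Lemma mx_norm_mulmx (m n k : nat) (A : 'M[R]_(m, n)) (B : 'M[R]_(n, k)) :
  `|A *m B| <= n%:R * `|A| * `|B|.
Proof.
apply: mx_norm_le => [|i j]; first by rewrite !mulr_ge0.
rewrite mxE (le_trans (ler_norm_sum _ _ _))//.
rewrite (@le_trans _ _ (\sum_(l < n) `|A| * `|B|))//.
  by apply: ler_sum => l _; rewrite normrM ler_pM// le_mx_norm.
by rewrite sumr_const card_ord -[leRHS]mulrA mulr_natl.
Qed.

Lemma continuous_mulmxr (q p : nat) (L : 'M[R]_(q, p)) :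
  continuous (fun h : 'rV[R]_q => h *m L).
Proof.
apply: (@lipschitz_continuous 'rV[R]_q 'rV[R]_p (q%:R * `|L| + 1)).
  by rewrite ltr_wpDl// mulr_ge0.
move=> x y; rewrite -mulmxBl (le_trans (mx_norm_mulmx _ _ _ _ _))//.
by rewrite mulrAC ler_wpM2r// lerDl.
Qed.

Lemma differentiable_eps (U W : normedModType R) (F : U -> W) (x : U)
    (L : {linear U -> W}) : continuous L ->
  (forall e, 0 < e -> exists2 d, 0 < d &
     forall h, `|h| < d -> `|F (x + h) - F x - L h| <= e * `|h|) ->
  differentiable F x /\ 'd F x = L :> (U -> W).
Proof.
move=> cL FL.
have FLo : F \o shift x = cst (F x) + L +o_ 0 id.
  apply/eqaddoP => e /FL [d d0 hd].
  apply/nbhs_ballP; exists d => //= h; rewrite -ball_normE/= sub0r normrN => /hd.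
  by rewrite !fctE /= opprD addrA (addrC h).
have dE := diff_unique cL FLo.
by split => //; apply/diff_locallyP; rewrite dE.
Qed.

Lemma differentiable_mulmxr (q p : nat) (F : 'rV[R]_q -> 'rV[R]_p)
    (x : 'rV[R]_q) (L : 'M[R]_(q, p)) :
  (forall e, 0 < e -> exists2 d, 0 < d &
     forall h : 'rV[R]_q, `|h| < d -> `|F (x + h) - F x - h *m L| <= e * `|h|) ->
  differentiable F x /\ forall h, 'd F x h = h *m L.
Proof.
move=> FL.
have cL : continuous (mulmxr L : 'rV[R]_q -> 'rV[R]_p).
  exact: continuous_mulmxr.
have [dF dE] := @differentiable_eps 'rV[R]_q 'rV[R]_p F x (mulmxr L) cL FL.
by split => // h; rewrite dE.
Qed.

End maxnorm.

Section rademacher.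
Variables (R : realType) (q p : nat) (K : R) (F : 'rV[R]_q -> 'rV[R]_p).
Hypothesis K0 : 0 < K.
Hypothesis FK : forall x y, `|F x - F y| <= K * `|x - y|.
Local Notation V := 'rV[R]_q.
Local Notation mu := (@lebesgue_measure R).

Let head_vec (k : nat) (h : V) := forall i : 'I_q, (k <= i)%N -> h 0 i = 0.

Let expands k (L : 'M[R]_(q, p)) (e d : R) : set V :=
  [set x | forall h, head_vec k h -> `|h| <= d ->
     `|F (x + h) - F x - h *m L| <= e * `|h|].

(* The natural numbers enumerate the pairs of a rational slope and a radius. *)
Let code (m : nat) : 'M[rat]_(q, p) * nat := odflt (0, 0%N) (unpickle m).

Let slope m : 'M[R]_(q, p) := map_mx ratr (code m).1.

Let radius m : R := (code m).2.+1%:R^-1.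

(** The quantifiers are countable so that this set is Borel. The slope is rational and may change
    with the tolerance; the true derivative only appears as a limit, in [good_differentiable]. *)
Let good k : set V :=
  \bigcap_n \bigcup_m expands k (slope m) n.+1%:R^-1 (radius m).

Let closed_expands k L e d : closed (expands k L e d).
Proof.
rewrite (_ : expands k L e d = \bigcap_(h in [set h | head_vec k h /\ `|h| <= d])
   [set x | `|F (x + h) - F x - h *m L| <= e * `|h|]); last first.
  apply/seteqP; split => x /= H h; first by move=> [] /H; exact.
  by move=> hk hd; exact: H.
apply: closed_bigI => h _.
apply: (@closed_le_fun R V (fun x => `|F (x + h) - F x - h *m L|)).
apply: (@lipschitz_continuous R V R^o (K + K)); first by rewrite addr_gt0.
move=> x y; rewrite (le_trans (ler_dist_dist _ _))//.
rewrite (_ : _ - _ = (F (x + h) - F (y + h)) - (F x - F y)); last first.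
  by apply/rowP => i; rewrite !mxE; ring.
rewrite (le_trans (ler_normB _ _))// mulrDl lerD//.
by rewrite (le_trans (FK _ _))// opprD addrACA subrr addr0.
Qed.

Lemma borel_good k : borel _ _ (good k).
Proof.
apply: bigcapT_measurable => n; apply: bigcupT_measurable => m.
exact: closed_borel (closed_expands _ _ _ _).
Qed.

Let slope_dense (L : 'M[R]_(q, p)) (e d : R) : 0 < e -> 0 < d ->
  exists m, `|slope m - L| <= e /\ radius m < d.
Proof.
move=> e0 d0; have [n nd] := ex_invS_lt _ _ d0.
have /choice[Q QL] : forall ij : 'I_q * 'I_p, exists r : rat, `|ratr r - L ij.1 ij.2| <= e.
  move=> [i j] /=.
  have [r] := @rat_in_itvoo R (L i j - e) (L i j + e) ltac:(lra).
  rewrite in_itv/= => /andP[r1 r2]; exists r.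
  by rewrite ler_norml; apply/andP; split; lra.
pose M : 'M[rat]_(q, p) := \matrix_(i, j) Q (i, j).
exists (pickle (M, n)); rewrite /slope /radius /code pickleK/=; split => //.
apply: mx_norm_le; first exact: ltW.
by move=> i j; rewrite !mxE; exact: (QL (i, j)).
Qed.

Let good0 x : good 0 x.
Proof.
move=> n _; exists 0%N => // h h0 _.
have -> : h = 0 by apply/rowP => i; rewrite h0// mxE.
by rewrite addr0 subrr mul0mx subr0 !normr0 mulr0.
Qed.

(** Two slopes that fit the same small displacement along an axis differ entrywise by at most the
    sum of their tolerances, so the slopes form a Cauchy sequence; their limit is the derivative. *)
Let good_differentiable x : good q x -> differentiable F x.
Proof.
move=> gx.
have /choice[m mP] : forall n : nat, exists m,
    expands q (slope m) n.+1%:R^-1 (radius m) x.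
  by move=> n; have [m _ ?] := gx n Logic.I; exists m.
have expE n (h : V) : `|h| <= radius (m n) ->
    `|F (x + h) - F x - h *m slope (m n)| <= n.+1%:R^-1 * `|h|.
  by move=> hr; apply: mP => // i; rewrite leqNgt ltn_ord.
have radius0 k : 0 < radius k by rewrite invr_gt0.
have slope_close n1 n2 i j :
    `|slope (m n1) i j - slope (m n2) i j| <= n1.+1%:R^-1 + n2.+1%:R^-1.
  pose d := Num.min (radius (m n1)) (radius (m n2)).
  have d0 : 0 < d by rewrite lt_min !radius0.
  pose h : V := d *: delta_mx 0 i.
  have hd : `|h| <= d.
    rewrite normrZ gtr0_norm// ler_piMr//; first exact: ltW.
    apply: mx_norm_le => // a b; rewrite mxE.
    by case: (_ && _); rewrite ?normr1 ?normr0.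
  have h1 := expE n1 h ltac:(by rewrite (le_trans hd)// ge_min lexx).
  have h2 := expE n2 h ltac:(by rewrite (le_trans hd)// ge_min lexx orbT).
  have : `|h *m slope (m n1) - h *m slope (m n2)| <= (n1.+1%:R^-1 + n2.+1%:R^-1) * d.
    rewrite (_ : _ - _ = (F (x + h) - F x - h *m slope (m n2)) -
        (F (x + h) - F x - h *m slope (m n1))); last first.
      by apply/rowP => a; rewrite !mxE; ring.
    rewrite (le_trans (ler_normB _ _))// addrC mulrDl lerD//.
      by rewrite (le_trans h1)// ler_wpM2l.
    by rewrite (le_trans h2)// ler_wpM2l.
  move=> /(le_trans (le_mx_norm _ _ _ _ 0 j)).
  rewrite -mulmxBr -scalemxAl -rowE !mxE normrM (gtr0_norm d0) mulrC.
  by rewrite ler_pM2r.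
(* Each entry of the limit is obtained as the supremum of the lower bounds given by the
   approximations. *)
pose D i j := [set slope (m n) i j - n.+1%:R^-1 | n in setT].
pose L : 'M[R]_(q, p) := \matrix_(i, j) sup (D i j).
have LE n i j : `|slope (m n) i j - L i j| <= n.+1%:R^-1.
  have Dub n2 : ubound (D i j) (slope (m n2) i j + n2.+1%:R^-1).
    move=> _ [n1 _ <-]; have := slope_close n1 n2 i j.
    rewrite ler_norml => /andP[_].
    by move: (n1.+1%:R^-1) (n2.+1%:R^-1) => u v; lra.
  have l1 : slope (m n) i j - n.+1%:R^-1 <= L i j.
    rewrite [leRHS]mxE; apply: ub_le_sup; last by exists n.
    by exists (slope (m n) i j + n.+1%:R^-1).
  have l2 : L i j <= slope (m n) i j + n.+1%:R^-1.
    rewrite [leLHS]mxE; apply: ge_sup => //.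
    by exists (slope (m n) i j - n.+1%:R^-1), n.
  move: (n.+1%:R^-1) l1 l2 => u l1 l2.
  by rewrite ler_norml; apply/andP; split; lra.
apply: (proj1 (differentiable_mulmxr _ _ _ _ _ L _)) => e e0.
have q0 : 0 < q%:R + 1 :> R by rewrite ltr_wpDl.
have [n nq] := ex_invS_lt _ _ (divr_gt0 e0 q0).
exists (radius (m n)) => // h /ltW hr.
rewrite (_ : _ - _ = (F (x + h) - F x - h *m slope (m n)) + h *m (slope (m n) - L)); last first.
  by rewrite mulmxBr; apply/rowP => a; rewrite !mxE; ring.
rewrite (le_trans (ler_normD _ _))//.
rewrite (@le_trans _ _ (n.+1%:R^-1 * `|h| + q%:R * `|h| * n.+1%:R^-1))//.
  rewrite lerD ?expE// (le_trans (mx_norm_mulmx _ _ _ _ _ _))// ler_wpM2l ?mulr_ge0//.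
  by apply: mx_norm_le => // i j; have := LE n i j; rewrite !mxE.
rewrite mulrAC -mulrDl ler_wpM2r// -[X in X + _]mul1r -mulrDl.
by rewrite mulrC -ler_pdivlMr// [1 + _]addrC ltW.
Qed.

Let delta_norm (k : 'I_q) : `|delta_mx 0 k : V| <= 1.
Proof.
apply: mx_norm_le => // a b; rewrite mxE.
by case: (_ && _); rewrite ?normr1 ?normr0.
Qed.

(* At almost every point of a line parallel to the k-th axis, the partial
   derivative exists and the sets [expands k L e d] that contain the point are
   not porous. A displacement by h is then made of a displacement along the
   axis to a nearby point of such a set, followed by one in head_vec k. *)
Let good_step (k : 'I_q) : null_along _ _ (delta_mx 0 k) (good k `\` good k.+1).
Proof.
move=> x; pose xt (t : R) : V := x + t *: delta_mx 0 k.
have mS : measurable ([set t | (good k `\` good k.+1) (xt t)] : set (measurableTypeR R)).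
  by apply: measurable_line; apply: measurableD; exact: borel_good.
apply: measure_negligible => //.
suff : {ae mu, forall t, good k (xt t) -> good k.+1 (xt t)}.
  move=> [N [mN N0 sN]]; exists N; split => // t /= [gt Ngt].
  by apply: sN => /= h; exact/Ngt/h.
have xtB s t : xt s - xt t = (s - t) *: delta_mx 0 k.
  by apply/rowP => i; rewrite !mxE; ring.
have nxt s t : `|xt s - xt t| <= `|s - t|.
  by rewrite xtB normrZ ler_piMr ?delta_norm.
have dF : {ae mu, forall t, derivable (F \o xt) t 1}.
  have : {ae mu, forall t, forall i : nat,
      if insub i is Some j then derivable (fun s => F (xt s) 0 (j : 'I_p)) t 1 else True}.
    apply/ae_foralln => i; case: insubP => [j _ _|_]; last exact: aeW.
    apply: (lipschitz_ae_derivable _ K) => // s t.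
    have := le_mx_norm _ _ _ (F (xt s) - F (xt t)) 0 j; rewrite !mxE => /le_trans; apply.
    by rewrite (le_trans (FK _ _))// ler_pM2l.
  apply: filterS; first exact: (ae_filter_ringOfSetsType mu).
  move=> t H; apply/derivable_mxP => a j; rewrite ord1.
  by have := H j; rewrite valK.
(* The codes [m] being countable, a single null set of parameters serves all the sets of expansion
   at once. *)
have nP : {ae mu, forall t, forall n m : nat, expands k (slope m) n.+1%:R^-1 (radius m) (xt t) ->
    forall e, 0 < e -> exists2 d, 0 < d & forall s, `|s| < d ->
      exists2 a, expands k (slope m) n.+1%:R^-1 (radius m) (xt a) & `|t + s - a| <= e * `|s|}.
  apply/ae_foralln => n; apply/ae_foralln => m.
  exact: (ae_nonporous _ [set t | expands k (slope m) n.+1%:R^-1 (radius m) (xt t)]).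
move: dF nP; apply: filterS2; first exact: (ae_filter_ringOfSetsType mu).
move=> t dFt nPt gt n _.
(* The sum of the coefficients of the errors [t1] to [t5] below, plus one. *)
pose C := K + K + 2 + q%:R + 1.
have C0 : 0 < C by rewrite ltr_wpDl// !addr_ge0// ltW.
pose e := n.+1%:R^-1 / C.
have e0 : 0 < e by rewrite divr_gt0.
have [N Ne] := ex_invS_lt _ _ e0.
have [m _ xm] := gt N Logic.I.
have [d1 d10 hd1] := nPt N m xm e e0.
pose z := 'D_1 (F \o xt) t.
have [d2 d20 hd2] : exists2 d2, 0 < d2 & forall s, `|s| < d2 ->
    `|F (xt (t + s)) - F (xt t) - s *: z| <= e * `|s|.
  have : \forall h \near 0^', `|z - h^-1 *: ((F \o xt) (h *: 1 + t) - (F \o xt) t)| < e.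
    by move/cvgrPdist_lt : dFt; exact.
  move=> [d2 /= d20 hd]; exists d2 => // s sd.
  have [->|s0] := eqVneq s 0.
    by rewrite addr0 subrr scale0r subr0 !normr0 mulr0.
  have := hd s; rewrite /= sub0r normrN => /(_ sd s0).
  rewrite /GRing.scale/= mulr1 (addrC s) => H.
  rewrite (_ : _ - _ = - (s *: (z - s^-1 *: (F (xt (t + s)) - F (xt t))))); last first.
    by rewrite scalerBr scalerA mulfV// scale1r opprB.
  by rewrite normrN normrZ mulrC ler_wpM2r// ltW.
(* Row [k] is the partial derivative along the axis, the other rows come from the expansion in
   [head_vec k]; [m'] then codes a rational approximation of this matrix. *)
pose L : 'M[R]_(q, p) := \matrix_(i, j) if i == k then z 0 j else slope m i j.
pose d := Num.min (radius m) (Num.min d1 d2).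
have d0 : 0 < d by rewrite !lt_min d10 d20 invr_gt0 ltr0n.
have [m' [m'L m'd]] := slope_dense L _ _ e0 d0.
exists m' => // h hk hm'.
have hd : `|h| < d by rewrite (le_lt_trans hm').
move: (hd); rewrite !lt_min => /and3P[hr h1 h2].
pose s := h 0 k.
have sh : `|s| <= `|h| by exact: le_mx_norm.
pose h' : V := h - s *: delta_mx 0 k.
have h'E i : h' 0 i = if i == k then 0 else h 0 i.
  by rewrite !mxE eqxx/=; case: eqP => [->|_]; rewrite ?mulr1 ?subrr// mulr0 subr0.
have h'head : head_vec k h'.
  move=> i ki; rewrite h'E; case: eqP => // /eqP ik; apply: hk.
  by rewrite ltn_neqAle ki andbT eq_sym.
have h'h : `|h'| <= `|h|.
  apply: mx_norm_le => // a i; rewrite ord1 h'E.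
  by case: ifP => _; [rewrite normr0|exact: le_mx_norm].
have [a xa ta] := hd1 s (le_lt_trans sh h1).
have hs := hd2 s (le_lt_trans sh h2).
have xh : xt t + h = xt (t + s) + h'.
  by apply/rowP => i; rewrite !mxE; ring.
have t1 : `|F (xt t + h) - F (xt a + h')| <= K * e * `|h|.
  rewrite xh (le_trans (FK _ _))// -mulrA ler_pM2l//.
  rewrite opprD addrACA subrr addr0 (le_trans (nxt _ _))// (le_trans ta)//.
  by rewrite ler_pM2l.
have t2 : `|F (xt a + h') - F (xt a) - h' *m slope m| <= e * `|h|.
  rewrite (le_trans (xa _ h'head _))//; first by rewrite (le_trans h'h)// ltW.
  by rewrite ler_pM// ltW.
have t3 : `|F (xt a) - F (xt (t + s))| <= K * e * `|h|.
  rewrite (le_trans (FK _ _))// -mulrA ler_pM2l// distrC (le_trans (nxt _ _))//.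
  by rewrite (le_trans ta)// ler_pM2l.
have t4 : `|F (xt (t + s)) - F (xt t) - s *: z| <= e * `|h|.
  by rewrite (le_trans hs)// ler_pM2l.
have t5 : `|h *m (L - slope m')| <= q%:R * e * `|h|.
  rewrite (le_trans (mx_norm_mulmx _ _ _ _ _ _))//.
  by rewrite -[leRHS]mulrA -[leLHS]mulrA ler_wpM2l// [leRHS]mulrC ler_wpM2l// distrC.
have hL : h *m L = h' *m slope m + s *: z.
  apply/rowP => j; rewrite !mxE (bigD1 k)//= [in RHS](bigD1 k)//= h'E eqxx mul0r add0r.
  rewrite mxE eqxx addrC; congr (_ + _).
  by apply: eq_bigr => i ik; rewrite h'E !mxE (negbTE ik).
rewrite (_ : _ - _ = (F (xt t + h) - F (xt a + h')) +
  (F (xt a + h') - F (xt a) - h' *m slope m) + (F (xt a) - F (xt (t + s))) +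
  (F (xt (t + s)) - F (xt t) - s *: z) + h *m (L - slope m')); last first.
  by rewrite mulmxBr hL; apply/rowP => i; rewrite !mxE; ring.
have -> : n.+1%:R^-1 = e * C by rewrite /e divfK// gt_eqF.
have tri (a1 a2 a3 a4 a5 : 'rV[R]_p) :
    `|a1 + a2 + a3 + a4 + a5| <= `|a1| + `|a2| + `|a3| + `|a4| + `|a5|.
  by do 3! (rewrite (le_trans (ler_normD _ _))// lerD//); exact: ler_normD.
apply: (le_trans (tri _ _ _ _ _)).
have eh0 : 0 <= e * `|h| by rewrite mulr_ge0// ltW.
apply: (le_trans (lerD (lerD (lerD (lerD t1 t2) t3) t4) t5)).
rewrite -subr_ge0 [X in 0 <= X](_ : _ = e * `|h|)//; rewrite /C; ring.
Qed.

(** Every point is in [good 0], so a point outside [good q] lies in some [good i] but not in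
    [good i.+1]. These differences are null along the axes, and [ex_transversal_line] finds a line
    that avoids them almost everywhere. *)
Lemma ex_line_ae_differentiable p0 w (r l : R) : 0 < r ->
  exists2 x, `|x - p0| <= r &
    {ae mu, forall t, 0 <= t <= l -> differentiable F (x + t *: w)}.
Proof.
move=> r0.
pose es : seq V := 0 :: [seq delta_mx 0 k | k : 'I_q].
(* From index [q] on, the sets are empty and the direction is 0, which is why [es] contains 0. *)
pose e (i : nat) : V := if insub i is Some k then delta_mx 0 (k : 'I_q) else 0.
pose B (i : nat) : set V := if (i < q)%N then good i `\` good i.+1 else set0.
have bB i : borel _ _ (B i).
  by rewrite /B; case: ifP => _; [apply: measurableD; exact: borel_good|exact: measurable0].
have [|i|x xp xB] := @ex_transversal_line R q es e B p0 w r l r0 _ bB.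
- move=> i; rewrite /e; case: insubP => [k _ _|_]; rewrite in_cons ?eqxx//.
  by rewrite map_f ?orbT// mem_enum.
- rewrite /B /e; case: insubP => [k kq ki|/negbTE ->]; first by rewrite kq -ki; exact: good_step.
  by move=> y; rewrite measure0.
exists x => //.
have : {ae mu, forall t, forall i : nat, ~ (0 <= t <= l /\ B i (x + t *: w))}.
  apply/ae_foralln => i; exists (`[0, l] `&` [set t | B i (x + t *: w)]); split.
  - by apply: measurableI => //; exact: measurable_line.
  - exact: xB.
  - by move=> t /= /contrapT; rewrite in_itv.
apply: filterS; first exact: (ae_filter_ringOfSetsType mu).
move=> t H tl; apply: good_differentiable.
have : forall i, (i <= q)%N -> good i (x + t *: w); last exact.
elim=> [_|i IHi iq]; first exact: good0.
apply: contrapT => Ngi; apply: (H i); split => //.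
by rewrite /B iq; split => //; apply: IHi; exact: ltnW.
Qed.

End rademacher.

(** * Euclidean norm and increments along lines *)

Definition dot (R : realType) (n : nat) (u v : 'rV[R]_n) : R :=
  \sum_(i < n) u 0 i * v 0 i.

Section euclidean.
Variable R : realType.
Implicit Types (n p q : nat).

Lemma dotC n (u v : 'rV[R]_n) : dot _ _ u v = dot _ _ v u.
Proof. by apply: eq_bigr => i _; rewrite mulrC. Qed.

Lemma dotDl n (u v w : 'rV[R]_n) : dot _ _ (u + v) w = dot _ _ u w + dot _ _ v w.
Proof. by rewrite -big_split; apply: eq_bigr => i _; rewrite mxE mulrDl. Qed.

Lemma dotZl n a (u v : 'rV[R]_n) : dot _ _ (a *: u) v = a * dot _ _ u v.
Proof. by rewrite mulr_sumr; apply: eq_bigr => i _; rewrite mxE mulrA. Qed.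

Lemma dotDr n (u v w : 'rV[R]_n) : dot _ _ u (v + w) = dot _ _ u v + dot _ _ u w.
Proof. by rewrite dotC dotDl !(dotC _ u). Qed.

Lemma dotZr n a (u v : 'rV[R]_n) : dot _ _ u (a *: v) = a * dot _ _ u v.
Proof. by rewrite dotC dotZl dotC. Qed.

Lemma dotNr n (u v : 'rV[R]_n) : dot _ _ u (- v) = - dot _ _ u v.
Proof. by rewrite -scaleN1r dotZr mulN1r. Qed.

Lemma dotNl n (u v : 'rV[R]_n) : dot _ _ (- u) v = - dot _ _ u v.
Proof. by rewrite dotC dotNr dotC. Qed.

Lemma dotBr n (u v w : 'rV[R]_n) : dot _ _ u (v - w) = dot _ _ u v - dot _ _ u w.
Proof. by rewrite dotDr dotNr. Qed.

Lemma dotBl n (u v w : 'rV[R]_n) : dot _ _ (u - v) w = dot _ _ u w - dot _ _ v w.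
Proof. by rewrite dotDl dotNl. Qed.

Lemma dot_mulmx n p (u : 'rV[R]_n) (A : 'M[R]_(n, p)) (v : 'rV[R]_p) :
  dot _ _ (u *m A) v = dot _ _ u (v *m A^T).
Proof.
have dotE k (a b : 'rV[R]_k) : dot _ _ a b = (a *m b^T) 0 0.
  by rewrite mxE; apply: eq_bigr => i _; rewrite mxE.
by rewrite !dotE trmx_mul trmxK mulmxA.
Qed.

Lemma enorm_ge0 n (u : 'rV[R]_n) : 0 <= enorm u.
Proof. exact: sqrtr_ge0. Qed.

Lemma enorm_sqr n (u : 'rV[R]_n) : enorm u ^+ 2 = dot _ _ u u.
Proof.
rewrite sqr_sqrtr; last by apply: sumr_ge0 => i _; exact: sqr_ge0.
by apply: eq_bigr => i _; rewrite expr2.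
Qed.

Lemma enormZ n a (u : 'rV[R]_n) : enorm (a *: u) = `|a| * enorm u.
Proof.
rewrite /enorm -sqrtr_sqr -sqrtrM ?sqr_ge0// mulr_sumr; congr Num.sqrt.
by apply: eq_bigr => i _; rewrite mxE exprMn.
Qed.

Lemma enormN n (u : 'rV[R]_n) : enorm (- u) = enorm u.
Proof. by rewrite -scaleN1r enormZ normrN1 mul1r. Qed.

Lemma enormB n (u v : 'rV[R]_n) : enorm (u - v) = enorm (v - u).
Proof. by rewrite -enormN opprB. Qed.

Lemma enorm0 n : enorm (0 : 'rV[R]_n) = 0.
Proof. by rewrite -(scale0r 0) enormZ normr0 mul0r. Qed.

Lemma dot_le n (u v : 'rV[R]_n) : dot _ _ u v <= enorm u * enorm v.
Proof.
have key (a b : 'rV[R]_n) : enorm a = 1 -> enorm b = 1 -> dot _ _ a b <= 1.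
  move=> a1 b1; have : 0 <= dot _ _ (a - b) (a - b) by rewrite -enorm_sqr sqr_ge0.
  rewrite dotBl !dotBr -!enorm_sqr a1 b1 (dotC _ b a); lra.
have ev0 (a : 'rV[R]_n) : enorm a = 0 -> a = 0.
  move=> a0; have := enorm_sqr _ a; rewrite a0 expr0n/= => /esym/eqP.
  rewrite psumr_eq0 => [/allP H|i _]; last by rewrite -expr2 sqr_ge0.
  apply/rowP => i; have := H i; rewrite mem_index_enum => /(_ isT).
  by rewrite mulf_eq0 orbb mxE => /eqP.
have [/ev0 ->|u0] := eqVneq (enorm u) 0.
  by rewrite -(scale0r 0) dotZl mul0r enormZ normr0 !mul0r.
have [/ev0 ->|v0] := eqVneq (enorm v) 0.
  by rewrite -(scale0r 0) dotZr mul0r enormZ normr0 mul0r mulr0.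
have up : 0 < enorm u by rewrite lt0r u0 enorm_ge0.
have vp : 0 < enorm v by rewrite lt0r v0 enorm_ge0.
have := key ((enorm u)^-1 *: u) ((enorm v)^-1 *: v).
rewrite !enormZ !gtr0_norm ?invr_gt0// !mulVf// => /(_ erefl erefl).
rewrite dotZl dotZr mulrA -invfM -ler_pdivlMl ?invr_gt0 ?mulr_gt0//.
by rewrite invrK mulr1 mulrC.
Qed.

Lemma ler_enormD n (u v : 'rV[R]_n) : enorm (u + v) <= enorm u + enorm v.
Proof.
rewrite -(ler_pXn2r (ltn0Sn 1)) ?nnegrE ?addr_ge0 ?enorm_ge0//.
rewrite enorm_sqr dotDl !dotDr (dotC _ v u) -!enorm_sqr sqrrD.
have := dot_le _ u v; lra.
Qed.

Lemma mx_norm_le_enorm n (u : 'rV[R]_n) : `|u| <= enorm u.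
Proof.
apply: mx_norm_le => [|i j]; first exact: enorm_ge0.
rewrite ord1 -sqrtr_sqr ler_sqrt ?sumr_ge0// => [|k _]; last exact: sqr_ge0.
by rewrite (bigD1 j)//= lerDl sumr_ge0// => k _; exact: sqr_ge0.
Qed.

Lemma enorm_le_mx_norm n (u : 'rV[R]_n) : enorm u <= (n%:R + 1) * `|u|.
Proof.
rewrite -(ler_pXn2r (ltn0Sn 1)) ?nnegrE ?enorm_ge0 ?mulr_ge0 ?addr_ge0//.
rewrite enorm_sqr (@le_trans _ _ (\sum_(i < n) `|u| ^+ 2))//.
  apply: ler_sum => i _; rewrite -expr2 -(real_normK (num_real (u 0 i))).
  by rewrite ler_pXn2r ?nnegrE// le_mx_norm.
rewrite sumr_const card_ord -[leLHS]mulr_natl exprMn ler_wpM2r ?sqr_ge0//.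
by have := ler0n R n; nra.
Qed.

Lemma enorm_row_mx n p (u : 'rV[R]_n) (v : 'rV[R]_p) :
  enorm (row_mx u v) ^+ 2 = enorm u ^+ 2 + enorm v ^+ 2.
Proof.
rewrite !enorm_sqr /dot big_split_ord/=; congr (_ + _); apply: eq_bigr => i _.
  by rewrite !row_mxEl.
by rewrite !row_mxEr.
Qed.

End euclidean.
Arguments dot {R n}.

Section mean_value.
Variables (R : realType) (q p : nat) (K : R) (F : 'rV[R]_q -> 'rV[R]_p).
Hypothesis K0 : 0 < K.
Hypothesis FK : forall x y, `|F x - F y| <= K * `|x - y|.
Local Notation mu := (@lebesgue_measure R).

Lemma norm_dot_le (v u : 'rV[R]_p) : `|dot v u| <= (p%:R * `|v| + 1) * `|u|.
Proof.
rewrite (le_trans (ler_norm_sum _ _ _))//.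
rewrite (@le_trans _ _ (\sum_(i < p) `|v| * `|u|))//.
  by apply: ler_sum => i _; rewrite normrM ler_pM// le_mx_norm.
by rewrite sumr_const card_ord -[leLHS]mulr_natl mulrA ler_wpM2r// lerDl.
Qed.

Lemma line_dot_derive1 (v : 'rV[R]_p) (x w : 'rV[R]_q) (t : R) :
  differentiable F (x + t *: w) ->
  (fun t => dot v (F (x + t *: w)))^`()%classic t = dot v ('d F (x + t *: w) w).
Proof.
set b := x + t *: w => dF.
have cq : h^-1 *: (F (h *: w + b) - F b) @[h --> 0^'] --> 'd F b w.
  by rewrite -deriveE//; exact: diff_derivable.
have cdot : continuous (dot v : 'rV[R]_p -> R^o).
  apply: (@lipschitz_continuous R 'rV[R]_p R^o (p%:R * `|v| + 1)).
    by rewrite ltr_wpDl// mulr_ge0.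
  by move=> a c; rewrite -dotBr norm_dot_le.
have := cvg_comp _ _ cq (cdot ('d F b w)).
rewrite derive1E => cd; apply/cvg_lim; first exact: Rhausdorff.
apply: cvg_trans cd; apply: near_eq_cvg; near=> h => /=.
rewrite dotZr dotBr /GRing.scale/= mulr1; congr (_ * (dot _ (F _) - _)).
by apply/rowP => i; rewrite !mxE; ring.
Unshelve. all: by end_near. Qed.

(** The segment itself may consist of points where [F] is not differentiable. It is moved to a
    nearby parallel segment on which [F] is differentiable almost everywhere; the bound on the
    derivative integrates there, and the displacement costs at most [e]. *)
Lemma dot_increment_ge (v : 'rV[R]_p) (w p0 : 'rV[R]_q) (r k : R) : 0 < r ->
  (forall b, `|b - p0| < r -> differentiable F b -> k <= dot v ('d F b w)) ->
  forall x l, `|x - p0| < r / 2 -> 0 < l -> l * `|w| < r / 4 ->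
  k * l <= dot v (F (x + l *: w) - F x).
Proof.
move=> r0 Fk x l xp l0 lw.
apply/ler_addgt0Pr => e e0.
pose C := p%:R * `|v| + 1.
have C0 : 0 < C by rewrite ltr_wpDl// mulr_ge0.
have CK : 0 < C * K by rewrite mulr_gt0.
have CK2 : 0 < 2 * (C * K) by rewrite mulr_gt0.
(* The first term keeps the moved segment in the ball of radius [r]; the second bounds by [e] the
   effect of moving both endpoints. *)
pose h := Num.min (r / 4) (e / (2 * (C * K))).
have h0 : 0 < h by rewrite lt_min !divr_gt0.
have [y yx aey] := ex_line_ae_differentiable _ _ _ _ _ K0 FK x w h l h0.
pose phi t := dot v (F (y + t *: w)).
have phiK s t : `|phi s - phi t| <= (C * (K * (`|w| + 1))) * `|s - t|.
  rewrite -dotBr (le_trans (norm_dot_le _ _))// -!mulrA ler_pM2l//.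
  rewrite (le_trans (FK _ _))// ler_pM2l// opprD addrACA subrr add0r -scalerBl normrZ mulrC.
  by rewrite ler_wpM2r// lerDl.
have CKw : 0 < C * (K * (`|w| + 1)) by rewrite !mulr_gt0// ltr_wpDl.
have : k * (l - 0) <= phi l - phi 0.
  apply: (lipschitz_ae_derive_ge _ _ _ _ _ _ CKw phiK) => //.
  move: aey; apply: filterS; first exact: (ae_filter_ringOfSetsType mu).
  move=> t dt /andP[t0 tl] _.
  have dFt : differentiable F (y + t *: w) by apply: dt; rewrite !ltW.
  rewrite line_dot_derive1//; apply: Fk => //.
  rewrite (_ : _ - p0 = (y - x) + (x - p0) + t *: w); last first.
    by apply/rowP => i; rewrite !mxE; ring.
  have hr : h <= r / 4 by rewrite ge_min lexx.
  have tw : `|t *: w| <= l * `|w| by rewrite normrZ gtr0_norm// ler_wpM2r// ltW.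
  have := ler_normD (y - x + (x - p0)) (t *: w).
  have := ler_normD (y - x) (x - p0).
  lra.
rewrite subr0 /phi -dotBr scale0r addr0 => /le_trans; apply.
rewrite -lerBlDl -dotBr.
have he : 2 * (C * K) * h <= e.
  by rewrite mulrC -ler_pdivlMr// ge_min lexx orbT.
apply: le_trans he; apply: le_trans (ler_norm _) _.
rewrite (le_trans (norm_dot_le _ _))// -/C.
rewrite (_ : _ - _ = (F (y + l *: w) - F (x + l *: w)) - (F y - F x)); last first.
  by apply/rowP => i; rewrite !mxE; ring.
rewrite (_ : 2 * (C * K) * h = C * (K * h + K * h)); last by ring.
rewrite ler_pM2l// (le_trans (ler_normB _ _))// lerD//.
  by rewrite (le_trans (FK _ _))// ler_pM2l// opprD addrACA subrr addr0.
by rewrite (le_trans (FK _ _))// ler_pM2l.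
Qed.

End mean_value.

(* w is the direction of an almost minimal element of Z. *)
Lemma convex_unit_direction (R : realType) (n : nat) (Z : set 'rV[R]_n) (D m0 : R) :
  Z !=set0 ->
  (forall a b t, Z a -> Z b -> 0 <= t -> t <= 1 -> Z (a + t *: (b - a))) ->
  (forall z, Z z -> enorm z <= D) -> 0 < m0 -> (forall z, Z z -> m0 <= enorm z) ->
  exists2 w, enorm w = 1 & forall z, Z z -> m0 / 2 <= dot z w.
Proof.
move=> [y0 Zy0] Zcvx ZD m00 Zm.
pose S := [set enorm z ^+ 2 | z in Z].
have Slb : has_lbound S by exists 0 => _ [z _ <-]; exact: sqr_ge0.
have S0 : S !=set0 by exists (enorm y0 ^+ 2), y0.
have D0 : 0 < D by rewrite (lt_le_trans m00)// (le_trans (Zm _ Zy0))// ZD.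
have mD : m0 <= D by rewrite (le_trans (Zm _ Zy0))// ZD.
(* The length of the step from the almost minimal [z0] towards [z]: it makes [th * (4 * D ^+ 2)]
   equal to [m0 ^+ 2 / 2], and with the excess [e] this gives [- m0 ^+ 2 <= 2 * dot z0 (z - z0)]. *)
pose th := m0 ^+ 2 / (8 * D ^+ 2).
have D2 : 0 < D ^+ 2 by rewrite exprn_gt0.
have m2 : 0 < m0 ^+ 2 by rewrite exprn_gt0.
have th0 : 0 < th by rewrite divr_gt0// mulr_gt0.
have m2D2 : m0 ^+ 2 <= D ^+ 2 by rewrite ler_pXn2r// nnegrE ltW.
have th1 : th <= 1 by rewrite ler_pdivrMr ?mulr_gt0// mul1r; lra.
have thD : th * D ^+ 2 = m0 ^+ 2 / 8.
  by rewrite /th; field; rewrite gt_eqF.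
pose e := th * m0 ^+ 2 / 2.
have e0 : 0 < e by rewrite divr_gt0// mulr_gt0.
have [_ [z0 Zz0 <-] z0e] := inf_adherent e0 (conj S0 Slb).
have N0 : 0 < enorm z0 by rewrite (lt_le_trans m00)// Zm.
exists ((enorm z0)^-1 *: z0).
  by rewrite enormZ gtr0_norm ?invr_gt0// mulVf// gt_eqF.
move=> z Zz.
have Zt := Zcvx z0 z th Zz0 Zz (ltW th0) th1.
have : inf S <= enorm (z0 + th *: (z - z0)) ^+ 2.
  by apply: ge_inf => //; exists (z0 + th *: (z - z0)).
rewrite enorm_sqr dotDl !dotDr dotZl !dotZr dotZl -!enorm_sqr (dotC _ _ (z - z0) z0) => h.
have zz : enorm (z - z0) ^+ 2 <= 4 * D ^+ 2.
  rewrite (_ : 4 * D ^+ 2 = (D + D) ^+ 2); last by ring.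
  rewrite ler_pXn2r ?nnegrE ?enorm_ge0 ?addr_ge0 ?(ltW D0)// (le_trans (ler_enormD _ _ _ _))//.
  by rewrite enormN lerD// ZD.
have h1 : th * (th * enorm (z - z0) ^+ 2) <= th * (m0 ^+ 2 / 2).
  rewrite ler_pM2l// (le_trans (_ : _ <= th * (4 * D ^+ 2)))//; first by rewrite ler_pM2l.
  by rewrite mulrCA thD; lra.
have h2 : 0 <= th * (2 * dot z0 (z - z0) + m0 ^+ 2).
  by rewrite /e in z0e; lra.
rewrite pmulr_rge0// dotBr -enorm_sqr in h2.
rewrite [leRHS]mulrC ler_pdivlMr// (dotC _ _ z z0).
have Nm := Zm _ Zz0.
have : m0 ^+ 2 <= enorm z0 ^+ 2 by rewrite ler_pXn2r// nnegrE ltW.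
have : m0 * enorm z0 <= enorm z0 ^+ 2 by rewrite expr2 ler_wpM2r// ltW.
lra.
Qed.

(** * Subsequences with an explicit rate of convergence *)

Section sequences.
Variable R : realType.

(** [l] is a cluster point of [u]. The rate and [n <= s n] take the place of a strictly increasing
    extraction. *)
Lemma compact_subseq (V : normedModType R) (A : set V) (u : nat -> V) :
  compact A -> (forall n, A (u n)) ->
  exists l (s : nat -> nat), [/\ A l, forall n, (n <= s n)%N &
    forall n, `|u (s n) - l| < n.+1%:R^-1].
Proof.
move=> cA uA.
have uAoo : (u @ \oo) A by exists 0%N => // k _; exact: uA.
have [l [Al cl]] := cA (u @ \oo) _ uAoo.
have /choice[s sP] : forall n, exists k, (n <= k)%N /\ `|u k - l| < n.+1%:R^-1.
  move=> n.
  have un : (u @ \oo) [set x | exists2 k, (n <= k)%N & x = u k].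
    by exists n => // k nk; exists k.
  have bl : nbhs l (ball l n.+1%:R^-1) by apply: nbhsx_ballx; rewrite invr_gt0.
  have [_ [[k nk ->]]] := cl _ _ un bl.
  by rewrite -ball_normE/= distrC => kl; exists k.
by exists l, s; split => // n; have [] := sP n.
Qed.

Lemma bounded_subseq n (u : nat -> 'rV[R]_n) (B : R) :
  (forall k, `|u k| <= B) ->
  exists l (s : nat -> nat), (forall k, (k <= s k)%N) /\
    forall k, `|u (s k) - l| < k.+1%:R^-1.
Proof.
move=> uB.
have cB : compact (closed_ball_ Num.norm (0 : 'rV[R]_n) B).
  apply: bounded_closed_compact; last exact: closed_closed_ball_.
  exists B; split; first exact: num_real.
  move=> M BM x; rewrite /closed_ball_/= sub0r normrN => /le_trans; apply; exact: ltW.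
have [|l [s [_ ks sl]]] := @compact_subseq _ _ u cB.
  by move=> k; rewrite /closed_ball_/= sub0r normrN.
by exists l, s.
Qed.

Lemma cvg_rate (V : normedModType R) (u : nat -> V) (l : V) :
  (forall n, `|u n - l| < n.+1%:R^-1) -> u @ \oo --> l.
Proof.
move=> ul; apply/cvgrPdist_lt => e e0; have [n ne] := ex_invS_lt _ _ e0.
exists n => // k /= nk; rewrite distrC (lt_trans (ul k))// (le_lt_trans _ ne)//.
by rewrite lef_pV2 ?posrE ?ltr0n// ler_nat.
Qed.

End sequences.

(** * Local solvability *)

Section local_solvability.
Variables (R : realType) (q j : nat) (K : R).
Variables (F : 'rV[R]_q -> 'rV[R]_j) (S : 'M[R]_(j, q)).
Hypothesis K0 : 0 < K.
Hypothesis FK : forall x y, enorm (F x - F y) <= K * enorm (x - y).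
Hypothesis S1 : forall w : 'rV[R]_j, enorm (w *m S) <= enorm w.
Implicit Types (v w : 'rV[R]_j) (b x p : 'rV[R]_q).

(** A Lipschitz constant of [F] for the max norms, for which differentiability is stated; it bounds
    the entries of the Jacobians. *)
Let N := K * (q%:R + 1).

Let N0 : 0 < N. Proof. by rewrite mulr_gt0// ltr_wpDl. Qed.

Let FN x y : `|F x - F y| <= N * `|x - y|.
Proof.
rewrite (le_trans (mx_norm_le_enorm _ _ _))// (le_trans (FK _ _))//.
by rewrite -mulrA ler_pM2l// enorm_le_mx_norm.
Qed.

Let diff_norm_le b h : differentiable F b -> `|'d F b h| <= N * `|h|.
Proof.
move=> dF.
have cq : t^-1 *: (F (t *: h + b) - F b) @[t --> 0^'] --> 'd F b h.
  by rewrite -deriveE//; exact: diff_derivable.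
have cl : closed [set y : 'rV[R]_j | `|y| <= N * `|h|].
  apply: (@closed_le_fun R 'rV[R]_j (fun y => `|y|)).
  exact: norm_continuous.
apply: (@closed_cvg _ _ _ _ _ _ cl _ _ cq); near=> t => /=.
have t0 : t != 0 by near: t; exact: nbhs_dnbhs_neq.
rewrite normrZ normfV mulrC ler_pdivrMr ?normr_gt0//.
by rewrite (le_trans (FN _ _))// addrK normrZ mulrCA [leRHS]mulrC.
Unshelve. all: by end_near. Qed.

Let jacobian_norm_le b i k : differentiable F b -> `|'J F b i k| <= N.
Proof.
move=> dF.
have -> : 'J F b i k = ('d F b (delta_mx 0 i)) 0 k.
  by rewrite -mul_rV_lin1 -rowE [RHS]mxE.
rewrite (le_trans (le_mx_norm _ _ _ _ _ _))// (le_trans (diff_norm_le _ _ dF))//.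
rewrite ler_piMr ?(ltW N0)//; apply: mx_norm_le => // a c; rewrite mxE.
by case: (_ && _); rewrite ?normr1 ?normr0.
Qed.

(** The generators of Clarke's generalized Jacobian at [p0]; the radius [r] confines the sequences
    to a cube on which [F] will agree with a map read in a chart. *)
Definition limit_jacobian p0 (r : R) (P : 'M[R]_(j, q)) :=
  exists xs : nat -> 'rV[R]_q,
    [/\ forall n, `|xs n - p0| < r /\ differentiable F (xs n),
        xs @ \oo --> p0 & (fun n => ('J F (xs n))^T) @ \oo --> P].

Lemma limit_jacobian_norm_le p0 r P : limit_jacobian p0 r P -> `|P| <= N.
Proof.
move=> [xs [xsd _ cP]].
have cl : closed [set P : 'M[R]_(j, q) | `|P| <= N].
  apply: (@closed_le_fun R 'M[R]_(j, q) (fun P => `|P|)).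
  exact: norm_continuous.
apply: (@closed_cvg _ _ _ _ _ _ cl _ _ cP); near=> n => /=.
apply: mx_norm_le => [|i k]; first exact: ltW.
by rewrite mxE; apply: jacobian_norm_le; have [] := xsd n.
Unshelve. all: by end_near. Qed.

(** Semicontinuity of the generalized Jacobian: if points of differentiability with a value below
    [c] accumulated at [p0], their bounded Jacobians would have a limit point, which is a limit
    Jacobian with value at most [c]. *)
Let dot_diff_ge v (w : 'rV[R]_q) (c k : R) p0 (r : R) : 0 < r -> c < k ->
  (forall P, limit_jacobian p0 r P -> k <= dot v (w *m P^T)) ->
  exists2 d, 0 < d &
    forall b, `|b - p0| < d -> differentiable F b -> c <= dot v ('d F b w).
Proof.
move=> r0 ck limk; apply: contrapT => noD.
have /choice[b bP] : forall n : nat, exists b, [/\ `|b - p0| < Num.min n.+1%:R^-1 r,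
    differentiable F b & dot v ('d F b w) < c].
  move=> n; apply: contrapT => nob; apply: noD.
  exists (Num.min n.+1%:R^-1 r); first by rewrite lt_min r0 invr_gt0 ltr0n.
  move=> b bp dF; rewrite leNgt; apply/negP => bc.
  by apply: nob; exists b.
have [|l [s [ns sl]]] := @bounded_subseq R _ (fun n => mxvec ('J F (b n))^T) N.
  move=> n; apply: mx_norm_le; first exact: ltW.
  move=> a i; rewrite ord1; case/mxvec_indexP: i => i1 i2.
  by rewrite mxvecE mxE; apply: jacobian_norm_le; have [] := bP n.
pose P : 'M[R]_(j, q) := vec_mx l.
have PJ n : `|('J F (b (s n)))^T - P| < n.+1%:R^-1.
  apply: le_lt_trans (sl n); apply: mx_norm_le => // i1 i2.
  have := le_mx_norm _ _ _ (mxvec ('J F (b (s n)))^T - l) 0 (mxvec_index i1 i2).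
  by rewrite -{1}(vec_mxK l) -/P -linearB/= mxvecE.
have bsn n : `|b (s n) - p0| < n.+1%:R^-1.
  have [+ _ _] := bP (s n); rewrite lt_min => /andP[/lt_le_trans + _]; apply.
  by rewrite lef_pV2 ?posrE ?ltr0n// ler_nat ltnS.
have /limk kP : limit_jacobian p0 r P.
  exists (b \o s); split.
  - by move=> n; have [+ dF _] := bP (s n); rewrite lt_min => /andP[_].
  - exact: (@cvg_rate _ 'rV[R]_q).
  - exact: (@cvg_rate _ 'M[R]_(j, q)).
pose C := (j%:R * `|v| + 1) * (q%:R * `|w| + 1).
have C0 : 0 < C by rewrite mulr_gt0// ltr_wpDl// mulr_ge0.
have kc0 : 0 < k - c by rewrite subr_gt0.
have [n nk] := ex_invS_lt _ _ (divr_gt0 kc0 C0).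
have [_ dF dc] := bP (s n).
have dE : 'd F (b (s n)) w = w *m ('J F (b (s n)))^T^T by rewrite trmxK mul_rV_lin1.
have : dot v (w *m P^T) - dot v ('d F (b (s n)) w) <= C * n.+1%:R^-1.
  rewrite -dotBr (le_trans (ler_norm _))// (le_trans (norm_dot_le _ _ _ _))//.
  rewrite -mulrA ler_pM2l; last by rewrite ltr_wpDl// mulr_ge0.
  rewrite dE -mulmxBr -linearB/= (le_trans (mx_norm_mulmx _ _ _ _ _ _))//.
  apply: ler_pM => //.
    by rewrite lerDl.
  apply: ltW; apply: le_lt_trans (PJ n); rewrite -[leRHS]normrN opprB.
  by apply: mx_norm_le => // i1 i2; rewrite mxE le_mx_norm.
have : C * n.+1%:R^-1 < k - c by rewrite mulrC -ltr_pdivlMr.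
move: (C * n.+1%:R^-1) => z; lra.
Qed.

(** The radius must not depend on [v]. Otherwise unit vectors that fail at radii tending to 0
    accumulate at some unit [v']. The direction found for [v'] has rate [k / 2]; it also serves for
    the nearby [v (s n)], at a loss of at most [k / 4]. *)
Lemma uniform_increment (k : R) p0 (r : R) : 0 < k -> 0 < r ->
  (forall v, enorm v = 1 -> exists2 w, enorm w = 1 &
     forall P, limit_jacobian p0 r P -> k <= dot v (w *m S *m P^T)) ->
  exists2 d, 0 < d & forall v, enorm v = 1 -> exists2 w, enorm w = 1 &
    forall p l, `|p - p0| < d -> 0 < l -> l < d ->
      k / 4 * l <= dot v (F (p + l *: (w *m S)) - F p).
Proof.
move=> k0 r0 H; apply: contrapT => noD.
have /choice[v vP] : forall n : nat, exists v, enorm v = 1 /\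
    ~ exists2 w, enorm w = 1 & forall p l, `|p - p0| < n.+1%:R^-1 -> 0 < l ->
      l < n.+1%:R^-1 -> k / 4 * l <= dot v (F (p + l *: (w *m S)) - F p).
  move=> n; apply: contrapT => nov; apply: noD.
  exists n.+1%:R^-1; first by rewrite invr_gt0.
  move=> v v1; apply: contrapT => now; apply: nov; exists v; split => //.
have [|v' [s [ns sv]]] := @bounded_subseq R _ v 1.
  by move=> n; rewrite (le_trans (mx_norm_le_enorm _ _ _))// (proj1 (vP n)).
have vclose n : enorm (v (s n) - v') <= (j%:R + 1) * n.+1%:R^-1.
  by rewrite (le_trans (enorm_le_mx_norm _ _ _))// ler_wpM2l ?addr_ge0// ltW.
have v'1 : enorm v' = 1.
  have j1 : 0 < j%:R + 1 :> R by rewrite ltr_wpDl.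
  apply/eqP; rewrite eq_le; apply/andP; split; apply/ler_addgt0Pr => e e0.
    have [n ne] := ex_invS_lt _ _ (divr_gt0 e0 j1).
    rewrite (_ : v' = v (s n) - (v (s n) - v')); last by rewrite subKr.
    rewrite (le_trans (ler_enormD _ _ _ _))// (proj1 (vP _)) enormN lerD2l.
    by rewrite (le_trans (vclose n))// mulrC -ler_pdivlMr// ltW.
  have [n ne] := ex_invS_lt _ _ (divr_gt0 e0 j1).
  rewrite -(proj1 (vP (s n))) -[X in enorm X](subrK v') addrC.
  rewrite (le_trans (ler_enormD _ _ _ _))// lerD2l.
  by rewrite (le_trans (vclose n))// mulrC -ler_pdivlMr// ltW.
have [w w1 wP] := H v' v'1.
have [d d0 dP] := dot_diff_ge v' (w *m S) (k / 2) k p0 r r0 ltac:(lra) wP.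
have incr := dot_increment_ge _ _ _ _ _ N0 FN v' (w *m S) p0 d (k / 2) d0 dP.
(* The first term keeps the segments within the reach of [incr]; the second makes the error due to
   replacing [v'] by [v (s n)] at most [k / 4 * l]. *)
pose c := Num.min (d / 4) (k / 4 / (K * (j%:R + 1))).
have Kj : 0 < K * (j%:R + 1) by rewrite mulr_gt0// ltr_wpDl.
have c0 : 0 < c by rewrite lt_min !divr_gt0.
have [n nc] := ex_invS_lt _ _ c0.
have [_] := vP (s n); apply; exists w => // p l pd l0 ld.
have sn : (s n).+1%:R^-1 < c.
  by rewrite (le_lt_trans _ nc)// lef_pV2 ?posrE ?ltr0n// ler_nat ltnS.
have cd : c <= d / 4 by rewrite ge_min lexx.
have wS : `|w *m S| <= 1.
  by rewrite (le_trans (mx_norm_le_enorm _ _ _))// (le_trans (S1 _))// w1.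
have lw : l * `|w *m S| < d / 4.
  by rewrite (le_lt_trans (ler_piMr (ltW l0) wS))// (lt_le_trans (lt_trans ld sn)).
have pd2 : `|p - p0| < d / 2 by have := lt_le_trans (lt_trans pd sn) cd; lra.
have := incr p l pd2 l0 lw.
set D := F _ - F _ => h1.
have h2 : dot (v' - v (s n)) D <= k / 4 * l.
  rewrite (le_trans (dot_le _ _ _ _))//.
  rewrite (@le_trans _ _ ((j%:R + 1) * n.+1%:R^-1 * (K * l)))//.
    rewrite ler_pM ?enorm_ge0//; first by rewrite enormB vclose.
    rewrite (le_trans (FK _ _))// ler_pM2l// addrC addKr enormZ gtr0_norm//.
    by rewrite ler_piMr ?(ltW l0)// (le_trans (S1 _))// w1.
  rewrite (_ : _ * (K * l) = n.+1%:R^-1 * (K * (j%:R + 1)) * l); last by ring.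
  rewrite ler_pM2r// -ler_pdivlMr// (le_trans (ltW nc))//.
  by rewrite ge_min lexx orbT.
move: h2; rewrite dotBl; lra.
Qed.

(* A point p + t S at which F takes the value F p0 is a minimizer over t of
   |F (p + t S) - F p0| + (k / 2) |t|: at a minimizer with a nonzero residual
   g, the direction attached to - g decreases the first term faster than the
   second one can increase. *)
Lemma solve_along (k : R) p0 (d r : R) : 0 < k -> 0 < d -> 0 < r ->
  (forall v, enorm v = 1 -> exists2 w, enorm w = 1 &
    forall p l, `|p - p0| < d -> 0 < l -> l < d ->
      k * l <= dot v (F (p + l *: (w *m S)) - F p)) ->
  exists2 e, 0 < e & forall p, `|p - p0| < e -> exists t : 'rV[R]_j,
    [/\ F (p + t *m S) = F p0, enorm t <= 2 * K / k * enorm (p - p0) &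
      `|p + t *m S - p0| < r].
Proof.
move=> k0 d0 r0 H.
pose m := Num.min d r.
have m0 : 0 < m by rewrite lt_min d0.
have q1 : 0 < q%:R + 1 :> R by rewrite ltr_wpDl.
have Kk0 : 0 < 2 * K / k by rewrite divr_gt0// mulr_gt0.
(* It bounds the ratio of the distance of the solution from [p0] to that of [p]: 1 for [p] itself,
   the rest for the displacement [t *m S]. *)
pose C := 1 + 2 * K / k * (q%:R + 1).
have C0 : 0 < C by rewrite addr_gt0// mulr_gt0.
exists (m / C); first by rewrite divr_gt0.
move=> p pp0.
pose Phi t := enorm (F (p + t *m S) - F p0) + k / 2 * enorm t.
have k2 : 0 < k / 2 by rewrite divr_gt0.
have Phi_ge0 t : 0 <= Phi t by rewrite addr_ge0 ?enorm_ge0// mulr_ge0 ?enorm_ge0// ltW.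
have Phi0 : Phi 0 <= K * enorm (p - p0).
  by rewrite /Phi mul0mx addr0 enorm0 mulr0 addr0.
have Phi_lip t t' : Phi t <= Phi t' + (K + k / 2) * enorm (t - t').
  rewrite /Phi mulrDl addrACA lerD//.
    rewrite (_ : F (p + t *m S) - F p0 =
      (F (p + t' *m S) - F p0) + (F (p + t *m S) - F (p + t' *m S))); last first.
      by apply/rowP => i; rewrite !mxE; ring.
    rewrite (le_trans (ler_enormD _ _ _ _))// lerD2l (le_trans (FK _ _))// ler_pM2l//.
    by rewrite opprD addrACA subrr add0r -mulmxBl S1.
  by rewrite -mulrDr ler_pM2l// -{1}(subrKC t' t) ler_enormD.
pose I := inf [set Phi t | t in setT].
have Ilb : has_lbound [set Phi t | t in setT] by exists 0 => _ [t _ <-].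
have I0 : [set Phi t | t in setT] !=set0 by exists (Phi 0), 0.
have IP t : I <= Phi t by apply: ge_inf => //; exists t.
have /choice[u uP] : forall n : nat, exists t, Phi t < I + n.+1%:R^-1.
  move=> n; have n0 : 0 < n.+1%:R^-1 :> R by rewrite invr_gt0.
  by have [_ [t _ <-] tI] := inf_adherent n0 (conj I0 Ilb); exists t.
(* The penalty term bounds the minimizing sequence; as [Phi] is Lipschitz, a limit point of it is a
   minimizer. *)
have [|t [s [ns st]]] := @bounded_subseq R _ u ((I + 1) / (k / 2)).
  move=> n; rewrite (le_trans (mx_norm_le_enorm _ _ _))// ler_pdivlMr// mulrC.
  have h1 : n.+1%:R^-1 <= 1 :> R by rewrite invf_le1// ler1n.
  have h2 := uP n; have h3 := enorm_ge0 _ _ (F (p + u n *m S) - F p0).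
  by move: h1 h2; rewrite /Phi; move: (n.+1%:R^-1) => z; lra.
have tmin t' : Phi t <= Phi t'.
  apply: le_trans (IP t'); apply/ler_addgt0Pr => e e0.
  pose D := 1 + (K + k / 2) * (j%:R + 1).
  have D0 : 0 < D by apply: addr_gt0 => //; apply: mulr_gt0; [exact: addr_gt0|rewrite ltr_wpDl].

  have [n ne] := ex_invS_lt _ _ (divr_gt0 e0 D0).
  have h1 : (K + k / 2) * enorm (t - u (s n)) <= (K + k / 2) * ((j%:R + 1) * n.+1%:R^-1).
    rewrite ler_pM2l ?addr_gt0// enormB (le_trans (enorm_le_mx_norm _ _ _))//.
    by rewrite ler_wpM2l ?addr_ge0// ltW.
  have h2 : (s n).+1%:R^-1 <= n.+1%:R^-1 :> R.
    by rewrite lef_pV2 ?posrE ?ltr0n// ler_nat ltnS.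
  have h3 := Phi_lip t (u (s n)); have h4 := uP (s n).
  have h5 : D * n.+1%:R^-1 < e by rewrite mulrC -ltr_pdivlMr.
  move: h1 h2 h3 h4 h5; rewrite /D.
  by move: (n.+1%:R^-1) ((s n).+1%:R^-1) => z z'; lra.
have tK : enorm t <= 2 * K / k * enorm (p - p0).
  have h1 := le_trans (tmin 0) Phi0.
  have h2 := enorm_ge0 _ _ (F (p + t *m S) - F p0).
  rewrite -(ler_pM2l k2) (_ : _ * (_ * _) = K * enorm (p - p0)); last first.
    by field; rewrite gt_eqF.
  by move: h1; rewrite /Phi; lra.
have ptm : `|p + t *m S - p0| < m.
  have h1 : enorm t <= 2 * K / k * (q%:R + 1) * `|p - p0|.
    by rewrite (le_trans tK)// -[leRHS]mulrA ler_pM2l// enorm_le_mx_norm.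
  have h2 : `|t *m S| <= enorm t by rewrite (le_trans (mx_norm_le_enorm _ _ _)).
  rewrite addrAC (le_lt_trans (ler_normD _ _))//.
  move: pp0; rewrite ltr_pdivlMr// mulrC /C mulrDl mul1r; lra.
exists t; split => //; last by apply: lt_le_trans ptm _; rewrite ge_min lexx orbT.
apply/eqP; rewrite -subr_eq0; apply: contrapT => /negP g0.
set g := _ - _ in g0.
have G0 : 0 < enorm g.
  by apply: lt_le_trans (mx_norm_le_enorm _ _ g); rewrite normr_gt0.
pose v := - ((enorm g)^-1 *: g).
have v1 : enorm v = 1 by rewrite enormN enormZ gtr0_norm ?invr_gt0// mulVf// gt_eqF.
have [w w1 wP] := H v v1.
(* The three terms allow the use of [wP], keep [enorm g - k / 2 * l] positive, and make the
   quadratic term [(K * l) ^+ 2] at most a quarter of the linear gain [2 * enorm g * k * l]. *)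
pose l := Num.min (d / 2) (Num.min (enorm g / k) (enorm g * k / (2 * K ^+ 2))).
have l0 : 0 < l by rewrite !lt_min !divr_gt0// ?mulr_gt0// exprn_gt0.
have ld : l < d by rewrite gt_min; apply/orP; left; lra.
have lg : l * k <= enorm g.
  by rewrite -ler_pdivlMr// /l 2!ge_min (lexx (enorm g / k)) orbT.
have lK : l * (2 * K ^+ 2) <= enorm g * k.
  rewrite -ler_pdivlMr ?mulr_gt0 ?exprn_gt0// /l 2!ge_min.
  by rewrite (lexx (enorm g * k / _)) !orbT.
have md : m <= d by rewrite ge_min lexx.
have incr := wP (p + t *m S) l (lt_le_trans ptm md) l0 ld.
set Delta := _ - _ in incr.
have DK : enorm Delta <= K * l.
  rewrite (le_trans (FK _ _))// ler_pM2l// addrC addKr enormZ gtr0_norm//.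
  by rewrite ler_piMr ?(ltW l0)// (le_trans (S1 _))// w1.
have gD : dot g Delta <= - (enorm g * (k * l)).
  move: incr; rewrite dotNl dotZl -(ler_pM2l G0) mulrN [X in - X]mulrA mulfV ?gt_eqF// mul1r.
  lra.
(* The residual drops by more than [k / 2 * l], the most by which the penalty can grow: this
   contradicts [tmin]. *)
have lt1 : enorm (g + Delta) < enorm g - k / 2 * l.
  have h0 : 0 < enorm g - k / 2 * l by lra.
  rewrite -(ltr_pXn2r (ltn0Sn 1)) ?nnegrE ?enorm_ge0 ?(ltW h0)//.
  rewrite enorm_sqr (dotDl _ _ g Delta) !(dotDr _ _ _ g Delta) (dotC _ _ Delta g) -!enorm_sqr.
  have h1 : enorm Delta ^+ 2 <= (K * l) ^+ 2.
    by rewrite ler_pXn2r ?nnegrE ?enorm_ge0// mulr_ge0// ltW.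
  have h2 : l * (l * (2 * K ^+ 2)) <= l * (enorm g * k) by rewrite ler_pM2l.
  have h3 : 0 < l * (enorm g * k) by rewrite !mulr_gt0.
  have h4 : 0 <= (k / 2 * l) ^+ 2 by exact: sqr_ge0.
  rewrite sqrrB; move: h1 h2 h3 h4 gD; rewrite !exprMn; move: (enorm Delta ^+ 2) => z.
  lra.
have := tmin (t + l *: w).
rewrite /Phi mulmxDl -scalemxAl addrA.
rewrite (_ : F (p + t *m S + l *: (w *m S)) - F p0 = g + Delta); last first.
  by rewrite /g /Delta; apply/rowP => i; rewrite !mxE; ring.
have : k / 2 * enorm (t + l *: w) <= k / 2 * (enorm t + l).
  by rewrite ler_pM2l// (le_trans (ler_enormD _ _ _ _))// enormZ w1 mulr1 gtr0_norm.
rewrite -/g; lra.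
Qed.

End local_solvability.

(** * Level sets in charts *)

Section lipschitz_constants.
Variable R : realType.

Lemma Lip_ge0 (p q : nat) (D : set 'rV[R]_p) (f : 'rV[R]_p -> 'rV[R]_q) :
  lipschitz_cont D f -> 0 <= Lip D f.
Proof.
move=> [k fk]; apply: lb_le_inf; last by move=> x [].
exists `|k|; split => // x y Dx Dy; rewrite (le_trans (fk x y Dx Dy))//.
by rewrite ler_wpM2r ?enorm_ge0// ler_norm.
Qed.

Lemma Lip_lipschitz (p q : nat) (D : set 'rV[R]_p) (f : 'rV[R]_p -> 'rV[R]_q) :
  lipschitz_cont D f -> lipschitz_with (Lip D f) D f.
Proof.
move=> [k fk] x y Dx Dy.
have [xy|xy] := eqVneq (enorm (x - y)) 0.
  by rewrite xy mulr0; have := fk x y Dx Dy; rewrite xy mulr0.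
have xy0 : 0 < enorm (x - y) by rewrite lt0r xy enorm_ge0.
rewrite -ler_pdivrMr//; apply: lb_le_inf.
  exists `|k|; split => // x' y' Dx' Dy'; rewrite (le_trans (fk x' y' Dx' Dy'))//.
  by rewrite ler_wpM2r ?enorm_ge0// ler_norm.
by move=> c [_ fc]; rewrite ler_pdivrMr//; exact: fc.
Qed.

Lemma finite_has_ubound (A : set R) : finite_set A -> has_ubound A.
Proof.
move=> /finite_seqP[s ->]; elim: s => [|a s [b sb]]; first by exists 0.
exists (Num.max a b) => x /=; rewrite in_cons => /orP[/eqP ->|xs].
  by rewrite le_max lexx.
by rewrite le_max (sb x xs) orbT.
Qed.

Lemma Lip_chart_le_LipM (n d : nat) (M : set 'rV[R]_n) (atlas : set (chart R n d)) psi :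
  is_lipschitz_manifold M atlas -> compact M -> atlas psi ->
  Lip (chart_img psi) (chart_inv psi) + Lip (chart_dom psi) (chart_map psi) <= LipM atlas.
Proof.
move=> [_ _ fin] /fin finA Apsi; apply: ub_le_sup; last by exists psi.
exact/finite_has_ubound/finite_image.
Qed.

End lipschitz_constants.

Section operator_norm.
Variable R : realType.

Lemma enorm_mulmx_le_opnorm (p q : nat) (O : 'M[R]_(p, q)) (x : 'rV[R]_q) :
  enorm (x *m O^T) <= opnorm O * enorm x.
Proof.
have [x0|x0] := eqVneq (enorm x) 0.
  have -> : x = 0.
    apply/eqP; rewrite -normr_le0.
    by rewrite (le_trans (mx_norm_le_enorm _ _ _))// x0.
  by rewrite mul0mx enorm0 enorm0 mulr0.
have xp : 0 < enorm x by rewrite lt0r x0 enorm_ge0.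
rewrite -ler_pdivrMr//; apply: ub_le_sup.
  exists ((p%:R + 1) * (q%:R * `|O^T|)) => _ [y /= y1 <-].
  rewrite (le_trans (enorm_le_mx_norm _ _ _))// ler_wpM2l ?addr_ge0//.
  rewrite (le_trans (mx_norm_mulmx _ _ _ _ _ _))// ler_wpM2r// ler_piMr//.
  by rewrite (le_trans (mx_norm_le_enorm _ _ _))// y1.
exists ((enorm x)^-1 *: x); first by rewrite /= enormZ gtr0_norm ?invr_gt0// mulVf.
by rewrite -scalemxAl enormZ gtr0_norm ?invr_gt0// mulrC.
Qed.

(** The operator norm controls [u *m (invmx N)^T], not [u *m invmx N]; pairing [u *m N *m invmx N]
    with [u] moves the inverse to the other factor, and Cauchy-Schwarz concludes. *)
Lemma enorm_le_opnorm_inv (j : nat) (N : 'M[R]_j) (t : R) (u : 'rV[R]_j) :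
  N \in unitmx -> opnorm (invmx N) <= t -> enorm u <= t * enorm (u *m N).
Proof.
move=> uN Nt.
have [u0|u0] := eqVneq (enorm u) 0.
  have -> : u = 0.
    apply/eqP; rewrite -normr_le0.
    by rewrite (le_trans (mx_norm_le_enorm _ _ _))// u0.
  by rewrite mul0mx enorm0 mulr0.
have up : 0 < enorm u by rewrite lt0r u0 enorm_ge0.
rewrite -(ler_pM2l up) -expr2 enorm_sqr -{1}(mulmxK uN u) dot_mulmx.
rewrite (le_trans (dot_le _ _ _ _))// [leRHS]mulrCA [leRHS]mulrA [leLHS]mulrC.
rewrite ler_wpM2r ?enorm_ge0//.
by rewrite (le_trans (enorm_mulmx_le_opnorm _ _ _ _))// ler_wpM2r ?enorm_ge0.
Qed.

End operator_norm.

Section convexity.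
Variable R : realType.

Lemma convex_setP (E : lmodType R) (A : set E) :
  @convex_set R E A <->
  forall a b t, A a -> A b -> 0 <= t -> t <= 1 -> A (a + t *: (b - a)).
Proof.
have convE (a b : E) (l : {i01 R}) :
    @conv R (convex_lmodType E) l a b = b + l%:num *: (a - b).
  change (l%:num *: a + (1 - l%:num) *: b = b + l%:num *: (a - b)).
  by rewrite scalerBl scale1r scalerBr addrCA.
split => [cA a b t Aa Ab t0 t1|cA a b l /set_mem Aa /set_mem Ab].
  have := cA b a (Itv01 t0 t1) (mem_set Ab) (mem_set Aa).
  by rewrite convE => /set_mem.
by apply/mem_set; rewrite convE; apply: cA.
Qed.

Lemma convex_conv_hull (p q : nat) (S : set 'M[R]_(p, q)) :
  @convex_set R 'M[R]_(p, q) (conv_hull S).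
Proof.
apply/convex_setP => a b t ha hb t0 t1 B [cB SB].
have /convex_setP := cB; apply => //; [exact: ha|exact: hb].
Qed.

Lemma sub_conv_hull (p q : nat) (S : set 'M[R]_(p, q)) : S `<=` conv_hull S.
Proof. exact: sub_gen_smallest. Qed.

Lemma conv_hull_sub (p q : nat) (S B : set 'M[R]_(p, q)) :
  @convex_set R 'M[R]_(p, q) B -> S `<=` B -> conv_hull S `<=` B.
Proof. exact: smallest_sub. Qed.

End convexity.

(** * Truncation to a cube, and following a level set in a product chart *)

Section local.
Variable R : realType.

Lemma differentiable_near_eq (U W : normedModType R) (f g : U -> W) (x : U) (d : R) :
  0 < d -> (forall y, `|y - x| < d -> f y = g y) ->
  differentiable f x -> differentiable g x /\ 'd g x = 'd f x :> (U -> W).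
Proof.
move=> d0 fg /diff_locallyP[cdf fE].
apply: differentiable_eps => // e e0.
have /eqaddoP/(_ e e0)/nbhs_ballP[r /= r0 rP] := fE.
exists (Num.min d r); first by rewrite lt_min d0.
move=> h; rewrite lt_min => /andP[hd hr].
have := rP h; rewrite -ball_normE/= sub0r normrN => /(_ hr).
rewrite !fctE/= -!fg ?subrr ?normr0 ?(addrC x) ?addrK//.
by rewrite opprD addrA.
Qed.

Lemma jacobianE q p (f : 'rV[R]_q -> 'rV[R]_p) (x : 'rV[R]_q) i k :
  'J f x i k = 'd f x (delta_mx 0 i) 0 k.
Proof.
have <- : delta_mx 0 i *m 'J f x = 'd f x (delta_mx 0 i) by exact: mul_rV_lin1.
by rewrite -rowE [RHS]mxE.
Qed.

(* Rewriting under 'J makes unification compare the two differentials by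
   conversion, which does not terminate in practice: hence the explicit term. *)
Lemma jacobian_eq q p (f g : 'rV[R]_q -> 'rV[R]_p) (x : 'rV[R]_q) :
  'd f x = 'd g x :> ('rV[R]_q -> 'rV[R]_p) -> 'J f x = 'J g x.
Proof.
move=> fg; apply/matrixP => i k.
have e1 := jacobianE _ _ f x i k.
have e2 := congr1 (fun h : 'rV[R]_q -> 'rV[R]_p => h (delta_mx 0 i) 0 k) fg.
have e3 := jacobianE _ _ g x i k.
exact: (etrans e1 (etrans e2 (esym e3))).
Qed.

Lemma ler_enorm n (u v : 'rV[R]_n) :
  (forall i, `|u 0 i| <= `|v 0 i|) -> enorm u <= enorm v.
Proof.
move=> uv; rewrite ler_sqrt; last by apply: sumr_ge0 => i _; exact: sqr_ge0.
apply: ler_sum => i _; rewrite -(real_normK (num_real (u 0 i))).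
by rewrite -(real_normK (num_real (v 0 i))) ler_pXn2r ?nnegrE//; exact: uv.
Qed.

(** Composition with this projection onto a cube extends a map that is Lipschitz on the cube to the
    whole space, with the same Euclidean constant. *)
Definition clamp q (p : 'rV[R]_q) (r : R) (x : 'rV[R]_q) : 'rV[R]_q :=
  \row_i Num.max (p 0 i - r) (Num.min (p 0 i + r) (x 0 i)).

Lemma clamp_id q (p : 'rV[R]_q) r x : `|x - p| <= r -> clamp q p r x = x.
Proof.
move=> xp; apply/rowP => i; rewrite mxE.
have := le_trans (le_mx_norm _ _ _ (x - p) 0 i) xp.
rewrite !mxE ler_norml => /andP[h1 h2].
by rewrite min_r ?max_r//; lra.
Qed.

Lemma clamp_dist q (p : 'rV[R]_q) r x : 0 <= r -> `|clamp q p r x - p| <= r.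
Proof.
move=> r0; apply: mx_norm_le => // a i; rewrite ord1 !mxE ler_norml.
case: (leP (p 0 i + r) (x 0 i)) => h1; case: (leP (p 0 i - r) _) => h2;
  apply/andP; split; lra.
Qed.

Lemma clamp_lipschitz q (p : 'rV[R]_q) r x y :
  enorm (clamp q p r x - clamp q p r y) <= enorm (x - y).
Proof.
apply: ler_enorm => i; rewrite !mxE.
have h := ler_norm (x 0 i - y 0 i).
have := ler_norm (- (x 0 i - y 0 i)); rewrite normrN => h'.
have h0 := normr_ge0 (x 0 i - y 0 i).
rewrite ler_norml.
case: (leP (p 0 i + r) (x 0 i)) => h1; case: (leP (p 0 i + r) (y 0 i)) => h2.
- by rewrite subrr; apply/andP; split; lra.
- by case: (leP (p 0 i - r) (p 0 i + r)) => h3; case: (leP (p 0 i - r) (y 0 i)) => h4;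
    apply/andP; split; lra.
- by case: (leP (p 0 i - r) (p 0 i + r)) => h3; case: (leP (p 0 i - r) (x 0 i)) => h4;
    apply/andP; split; lra.
- by case: (leP (p 0 i - r) (x 0 i)) => h3; case: (leP (p 0 i - r) (y 0 i)) => h4;
    apply/andP; split; lra.
Qed.

(** The products of the unit vector [v] with the matrices [P *m S^T] form a bounded convex set of
    vectors of norm at least [t^-1]; [convex_unit_direction] keeps half of this bound. Without limit
    Jacobians the claim is vacuous. *)
Lemma increasing_direction (q j : nat) (K : R) (F : 'rV[R]_q -> 'rV[R]_j)
    (S : 'M[R]_(j, q)) (p0 : 'rV[R]_q) (r t : R) : 0 < K ->
  (forall x y, enorm (F x - F y) <= K * enorm (x - y)) -> 0 < t ->
  (forall P, conv_hull (limit_jacobian _ _ _ F p0 r) P ->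
     P *m S^T \in unitmx /\ opnorm (invmx (P *m S^T)) <= t) ->
  forall v, enorm v = 1 -> exists2 w, enorm w = 1 &
    forall P, limit_jacobian _ _ _ F p0 r P -> (2 * t)^-1 <= dot v (w *m S *m P^T).
Proof.
move=> K0 FK t0 H v v1.
set J := limit_jacobian _ _ _ F p0 r in H *.
have [J0|/set0P[P0 JP0]] := eqVneq J set0.
  by exists v => // P; rewrite J0.
pose Z := [set v *m (P *m S^T) | P in conv_hull J].
pose N := K * (q%:R + 1).
pose D := (j%:R + 1) * (j%:R * `|v| * (q%:R * N * `|S^T|)).
have N0 : 0 <= N by rewrite mulr_ge0 ?addr_ge0// ltW.
have Z0 : Z !=set0 by exists (v *m (P0 *m S^T)), P0 => //; exact: sub_conv_hull.
have Zcvx a b s : Z a -> Z b -> 0 <= s -> s <= 1 -> Z (a + s *: (b - a)).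
  move=> [Pa Ja <-] [Pb Jb <-] s0 s1.
  exists (Pa + s *: (Pb - Pa)).
    by have /convex_setP := @convex_conv_hull R _ _ J; apply.
  by rewrite mulmxDl mulmxDr -scalemxAl -scalemxAr mulmxBl mulmxBr.
have JN P : conv_hull J P -> `|P| <= N.
  have cB : @convex_set R 'M[R]_(j, q) [set P | `|P| <= N].
    apply/convex_setP => a b s /= aN bN s0 s1.
    rewrite (_ : a + _ = (1 - s) *: a + s *: b); last first.
      by rewrite scalerBl scale1r scalerBr addrAC -addrA.
    rewrite (le_trans (ler_normD _ _))// !normrZ (ger0_norm s0).
    rewrite ger0_norm ?subr_ge0// [leRHS](_ : _ = (1 - s) * N + s * N); last by ring.
    by rewrite lerD// ler_wpM2l// subr_ge0.
  apply: (conv_hull_sub _ _ _ _ _ cB) => {}P.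
  exact: (limit_jacobian_norm_le _ _ _ _ _ K0 FK).
have ZD z : Z z -> enorm z <= D.
  move=> [P JP <-]; rewrite (le_trans (enorm_le_mx_norm _ _ _))//.
  rewrite ler_wpM2l ?addr_ge0// (le_trans (mx_norm_mulmx _ _ _ _ _ _))//.
  rewrite ler_wpM2l ?mulr_ge0// (le_trans (mx_norm_mulmx _ _ _ _ _ _))//.
  by rewrite ler_wpM2r// ler_wpM2l// JN.
have Zm z : Z z -> t^-1 <= enorm z.
  move=> [P JP <-]; have [uP tP] := H P JP.
  have := enorm_le_opnorm_inv _ _ _ _ v uP tP.
  by rewrite v1 -ler_pdivrMl// mulr1.
have ti0 : 0 < t^-1 by rewrite invr_gt0.
have [w w1 wP] := convex_unit_direction _ _ _ _ _ Z0 Zcvx ZD ti0 Zm.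
exists w => // P JP.
have := wP (v *m (P *m S^T)).
rewrite mulmxA !dot_mulmx trmxK -[in X in X -> _](mulmxA w) => h.
rewrite -mulmxA invfM mulrC; apply: h.
by exists P; [exact: sub_conv_hull|rewrite mulmxA].
Qed.

Lemma norm_lsubmx_le n p (v : 'rV[R]_(n + p)) : `|lsubmx v| <= `|v|.
Proof. by apply: mx_norm_le => // i k; rewrite mxE le_mx_norm. Qed.

Lemma norm_rsubmx_le n p (v : 'rV[R]_(n + p)) : `|rsubmx v| <= `|v|.
Proof. by apply: mx_norm_le => // i k; rewrite mxE le_mx_norm. Qed.

Lemma open_row_prod_cube (d m : nat) (V : set 'rV[R]_d) (A : set 'rV[R]_m) p0 :
  open V -> open A -> row_prod V A p0 ->
  exists2 r, 0 < r & forall p, `|p - p0| <= r -> row_prod V A p.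
Proof.
move=> oV oA [Vp Ap].
have /nbhs_ballP[r1 /= r10 rV] : nbhs (lsubmx p0) V by exact: open_nbhs_nbhs.
have /nbhs_ballP[r2 /= r20 rA] : nbhs (rsubmx p0) A by exact: open_nbhs_nbhs.
pose r := Num.min r1 r2.
have r0 : 0 < r by rewrite lt_min r10.
exists (r / 2); first by rewrite divr_gt0.
move=> p pp0; have pr : `|p - p0| < r by lra.
move: pr; rewrite lt_min => /andP[pr1 pr2]; split.
  apply: rV; rewrite -ball_normE/= distrC -linearB/=.
  exact: le_lt_trans (norm_lsubmx_le _ _ _) pr1.
apply: rA; rewrite -ball_normE/= distrC -linearB/=.
exact: le_lt_trans (norm_rsubmx_le _ _ _) pr2.
Qed.

Lemma enorm_row_mx_le n n' p (a : R) (u : 'rV[R]_n) (v : 'rV[R]_p) (u' : 'rV[R]_n') :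
  0 <= a -> enorm u' <= a * enorm u ->
  enorm (row_mx u' v) <= (a + 1) * enorm (row_mx u v).
Proof.
move=> a0 ua.
have a1 : 0 <= a + 1 by rewrite addr_ge0.
rewrite -(ler_pXn2r (ltn0Sn 1)) ?nnegrE ?enorm_ge0 ?mulr_ge0 ?enorm_ge0//.
rewrite exprMn !enorm_row_mx mulrDr lerD//.
  rewrite (@le_trans _ _ ((a * enorm u) ^+ 2))//.
    by rewrite ler_pXn2r ?nnegrE ?enorm_ge0// mulr_ge0 ?enorm_ge0.
  by rewrite exprMn ler_wpM2r ?sqr_ge0// ler_pXn2r ?nnegrE// lerDl.
by rewrite ler_peMl ?sqr_ge0// expr_ge1 ?lerDr.
Qed.

Lemma enorm_row_mx0 n p (u : 'rV[R]_n) : enorm (row_mx u (0 : 'rV[R]_p)) = enorm u.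
Proof.
apply: (@pexpIrn _ 2) => //; rewrite ?nnegrE ?enorm_ge0//.
by rewrite enorm_row_mx enorm0 expr0n/= addr0.
Qed.

Lemma enorm_row_mx0l n p (v : 'rV[R]_p) : enorm (row_mx (0 : 'rV[R]_n) v) = enorm v.
Proof.
apply: (@pexpIrn _ 2) => //; rewrite ?nnegrE ?enorm_ge0//.
by rewrite enorm_row_mx enorm0 expr0n/= add0r.
Qed.

(* The inclusion of R^j, as the coordinates listed by pi, into R^(d + m). *)
Definition incl_mx (d m j : nat) (pi : 'I_j -> 'I_d) : 'M[R]_(j, d + m) :=
  row_mx (rowsub pi 1%:M) 0.

Lemma mulmx_incl_tr (d m j p : nat) (pi : 'I_j -> 'I_d) (P : 'M[R]_(p, d + m)) :
  P *m (incl_mx d m j pi)^T = colsub pi (lsubmx P).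
Proof.
rewrite /incl_mx tr_row_mx -{1}(hsubmxK P) mul_row_col trmx0 mulmx0 addr0.
apply/matrixP => a b; rewrite !mxE (bigD1 (pi b))//= !mxE eqxx mulr1 big1 ?addr0//.
by move=> k kb; rewrite !mxE eq_sym (negbTE kb) mulr0.
Qed.

Lemma enorm_mulmx_incl (d m j : nat) (pi : 'I_j -> 'I_d) (w : 'rV[R]_j) :
  injective pi -> enorm (w *m incl_mx d m j pi) = enorm w.
Proof.
move=> inj_pi.
apply: (@pexpIrn _ 2) => //; rewrite ?nnegrE ?enorm_ge0// !enorm_sqr dot_mulmx.
congr (dot _ _); rewrite mulmx_incl_tr /incl_mx mul_mx_row row_mxKl.
apply/rowP => b; rewrite !mxE (bigD1 b)//= !mxE eqxx mulr1 big1 ?addr0//.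
by move=> k kb; rewrite !mxE (inj_eq inj_pi) (negbTE kb) mulr0.
Qed.

Section level_set.
Variables (n d m j : nat) (M : set 'rV[R]_n) (atlas : set (chart R n d)).
Variables (A : set 'rV[R]_m) (c : 'rV[R]_(n + m) -> 'rV[R]_j).
Hypothesis manM : is_lipschitz_manifold M atlas.
Hypothesis compM : compact M.
Hypothesis openA : open A.
Hypothesis lipc : lipschitz_cont (row_prod M A) c.

Let LM := LipM atlas.
(** A Lipschitz constant of [c] read in a product chart, where the inverse chart acts on the first
    block and the identity on the second; the added units also make it positive. *)
Let K := (Lip (row_prod M A) c + 1) * (LM + 1).

(** The parameter is set to [x'] and only the chart coordinates listed by [pi] are adjusted, by
    [solve_along]. In its rate, [(2 * t)^-1] comes from [increasing_direction] and the division by 4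
    from [uniform_increment]; the factor [LM] is the cost of the inverse chart. The constant depends
    on neither [u] nor [x]. *)
Lemma local_level_set (t : R) (u : 'rV[R]_n) (x : 'rV[R]_m) (pi : 'I_j -> 'I_d) :
  M u -> A x -> 0 < t -> multi_index pi ->
  mx_set_invertible (E_set atlas A c u x pi) ->
  (forall N, E_set atlas A c u x pi N -> opnorm (invmx N) <= t) ->
  exists2 e, 0 < e & forall x', `|x' - x| < e ->
    exists u', [/\ M u', c (row_mx u' x') = c (row_mx u x) &
      enorm (u' - u) <= LM * (2 * K / ((2 * t)^-1 / 4)) * enorm (x' - x)].
Proof.
move=> Mu Ax t0 pi_mi invE normE.
have [chartP coverP _] := manM.
have [psi Apsi domu] := coverP u Mu.
have [[Om oOm domE] oV mapP invP [lip_map lip_inv] ] := chartP psi Apsi.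
have [Vs0 invs0] := mapP u domu.
set s0 := chart_map psi u in Vs0 invs0.
pose p0 : 'rV[R]_(d + m) := row_mx s0 x.
have Lc0 : 0 <= Lip (row_prod M A) c by exact: Lip_ge0.
have Lpsi0 := Lip_ge0 _ _ _ _ _ lip_inv.
have LpsiM : Lip (chart_img psi) (chart_inv psi) <= LM.
  apply: le_trans (Lip_chart_le_LipM _ _ _ _ _ _ manM compM Apsi).
  by rewrite lerDl Lip_ge0.
have LM0 : 0 <= LM by exact: le_trans LpsiM.
have K0 : 0 < K by rewrite mulr_gt0// ltr_wpDl.
pose f := c \o chart_inv (prod_chart psi A).
have [rho rho0 rhoP] : exists2 r, 0 < r &
    forall p, `|p - p0| <= r -> row_prod (chart_img psi) A p.
  by apply: open_row_prod_cube => //; split; rewrite ?row_mxKl ?row_mxKr.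
(* The results on local solvability need a map that is Lipschitz everywhere; [F] agrees with [f] on
   the cube of radius [rho]. *)
pose F := f \o clamp _ p0 rho.
have fF p : `|p - p0| < rho -> F p = f p.
  by move=> pr; rewrite /F/= clamp_id// ltW.
have FK p p' : enorm (F p - F p') <= K * enorm (p - p').
  have cl y := rhoP _ (clamp_dist _ p0 rho y (ltW rho0)).
  rewrite /F/= /f/=.
  move: (cl p) (cl p') (clamp_lipschitz _ p0 rho p p').
  move: (clamp _ p0 rho p) (clamp _ p0 rho p') => y y' [Vy Ay] [Vy' Ay'] yy'.
  have [dy _] := invP _ Vy; have [dy' _] := invP _ Vy'.
  rewrite (le_trans (Lip_lipschitz _ _ _ _ _ lipc _ _ _ _))//.
  - by split; rewrite ?row_mxKl ?row_mxKr//; move: dy; rewrite domE => -[].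
  - by split; rewrite ?row_mxKl ?row_mxKr//; move: dy'; rewrite domE => -[].
  rewrite opp_row_mx add_row_mx /K -mulrA ler_pM ?enorm_ge0//; first by rewrite lerDl.
  have := Lip_lipschitz _ _ _ _ _ lip_inv _ _ Vy Vy'; rewrite -linearB/= => h.
  have := enorm_row_mx_le _ _ _ _ (lsubmx (y - y')) (rsubmx y - rsubmx y') _ Lpsi0 h.
  rewrite -[X in row_mx (lsubmx _) X]linearB/= hsubmxK => /le_trans; apply.
  apply: ler_pM; rewrite ?enorm_ge0 ?addr_ge0//; last by rewrite lerD2r.
pose S := incl_mx d m j pi.
have inj_pi : injective pi.
  move=> a b pab; apply/val_inj/eqP; case: ltngtP => // ab;
    have := pi_mi _ _ ab; by rewrite pab ltnn.
have SE w : enorm (w *m S) = enorm w by exact: enorm_mulmx_incl.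
(* [F] and [f] have the same Jacobians inside the cube, so the hull lies in the generalized Jacobian
   of [c]; the right block of [P] is the matrix [Q] required by the partial Jacobian. *)
have limE P : conv_hull (limit_jacobian _ _ _ F p0 rho) P ->
    E_set atlas A c u x pi (P *m S^T).
  move=> JP; exists (lsubmx P); last by rewrite mulmx_incl_tr.
  exists (rsubmx P); rewrite hsubmxK.
  apply: (conv_hull_sub _ _ _ _ _ (convex_conv_hull _ _ _ _)) JP => {}P [xs [xsr xsp xsP]].
  apply: sub_conv_hull; exists (prod_chart psi A).
    split; first by exists psi.
    by split; rewrite ?row_mxKl ?row_mxKr.
  apply: sub_conv_hull; exists xs.
  have xsf k : differentiable f (xs k) /\ 'd f (xs k) = 'd F (xs k) :> (_ -> _).
    have [kr dk] := xsr k.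
    apply: (@differentiable_near_eq _ _ F f (xs k) (rho - `|xs k - p0|)) => //.
      by rewrite subr_gt0.
    move=> y yk; apply: fF; rewrite -(subrK (xs k) y) -addrA.
    by rewrite (le_lt_trans (ler_normD _ _))// -ltrBrDr.
  split.
  - move=> k; split; last exact: (xsf k).1.
    by apply: rhoP; apply: ltW; have [] := xsr k.
  - by rewrite /= row_mxKl row_mxKr.
  - have JE : (fun k => ('J F (xs k))^T) = (fun k => ('J f (xs k))^T).
      apply/funext => k.
      exact: (congr1 trmx (jacobian_eq _ _ F f (xs k) (esym (xsf k).2))).
    by rewrite JE in xsP; exact: xsP.
have kt0 : 0 < (2 * t)^-1 by rewrite invr_gt0 mulr_gt0.
have kt4 : 0 < (2 * t)^-1 / 4 by rewrite divr_gt0.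
have dirs := increasing_direction _ _ _ F S p0 rho t K0 FK t0
  (fun P JP => conj (invE _ (limE P JP)) (normE _ (limE P JP))).
have [|d1 d10 incr] := uniform_increment _ _ _ _ F S K0 FK _ _ p0 rho kt0 rho0 dirs.
  by move=> w; rewrite SE.
have [|e e0 solve] := solve_along _ _ _ _ F S K0 FK _ _ p0 d1 rho kt4 d10 rho0 incr.
  by move=> w; rewrite SE.
exists e => // x' xx'.
pose p : 'rV[R]_(d + m) := row_mx s0 x'.
have pp0 : p - p0 = row_mx 0 (x' - x) by rewrite opp_row_mx add_row_mx subrr.
have [|w [Fw wle wr]] := solve p.
  rewrite pp0; apply: le_lt_trans xx'; apply: mx_norm_le => // a i.
  rewrite mxE; case: splitP => k _; first by rewrite mxE normr0.
  exact: le_mx_norm.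
pose s := s0 + w *m rowsub pi 1%:M.
have psE : p + w *m S = row_mx s x'.
  by rewrite /S /incl_mx mul_mx_row mulmx0 add_row_mx addr0.
have [Vs _] := rhoP _ (ltW wr).
rewrite psE row_mxKl in Vs.
have [ds _] := invP _ Vs.
exists (chart_inv psi s); split.
- by move: ds; rewrite domE => -[].
- move: Fw; rewrite !fF ?subrr ?normr0// /f/= psE !row_mxKl !row_mxKr.
  by rewrite invs0.
rewrite -{1}invs0 (le_trans (Lip_lipschitz _ _ _ _ _ lip_inv _ _ Vs Vs0))//.
rewrite -mulrA ler_pM ?enorm_ge0//.
rewrite (_ : s - s0 = w *m rowsub pi 1%:M); last by rewrite addrC addKr.
rewrite -(enorm_row_mx0 _ m) (_ : row_mx _ 0 = w *m S); last first.
  by rewrite /S /incl_mx mul_mx_row mulmx0.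
by rewrite SE (le_trans wle)// pp0 enorm_row_mx0l.
Qed.

End level_set.

End local.

(** * Continuation and the Hausdorff distance *)

Section global.
Variables (R : realType) (n m j : nat) (M : set 'rV[R]_n) (A : set 'rV[R]_m).
Variable c : 'rV[R]_(n + m) -> 'rV[R]_j.
Hypothesis compM : compact M.
Hypothesis lipc : lipschitz_cont (row_prod M A) c.

Let Lc := Lip (row_prod M A) c.

Let Lc0 : 0 <= Lc. Proof. exact: Lip_ge0. Qed.

Let c_lip u u' x x' : M u -> M u' -> A x -> A x' ->
  enorm (c (row_mx u x) - c (row_mx u' x')) <= Lc * (enorm (u - u') + enorm (x - x')).
Proof.
move=> Mu Mu' Ax Ax'.
rewrite (le_trans (Lip_lipschitz _ _ _ _ _ lipc _ _ _ _))//.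
- by split; rewrite ?row_mxKl ?row_mxKr.
- by split; rewrite ?row_mxKl ?row_mxKr.
rewrite opp_row_mx add_row_mx ler_wpM2l//.
rewrite (_ : row_mx _ _ = row_mx (u - u') 0 + row_mx 0 (x - x')); last first.
  by rewrite add_row_mx addr0 add0r.
by rewrite (le_trans (ler_enormD _ _ _ _))// enorm_row_mx0 enorm_row_mx0l.
Qed.

Lemma compact_U_set (C : set 'rV[R]_j) (x : 'rV[R]_m) :
  A x -> closed C -> compact (U_set M C c x).
Proof.
move=> Ax cC.
have sub : U_set M C c x `<=` M by move=> u [].
apply: (subclosed_compact _ compM sub) => l Ul.
have cM : closed M by apply: compact_closed => //; exact: norm_hausdorff.
have Ml : M l by apply: cM; move: Ul; exact: closure_subset.
split => //.
have /choice[u uP] : forall k : nat, exists u, U_set M C c x u /\ `|u - l| < k.+1%:R^-1.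
  move=> k; have k0 : 0 < k.+1%:R^-1 :> R by rewrite invr_gt0.
  have [u [Uu]] := Ul _ (nbhsx_ballx l _ k0).
  by rewrite -ball_normE/= distrC; exists u.
have cl : closed [set y | C y] by [].
have cu : (fun k => c (row_mx (u k) x)) @ \oo --> c (row_mx l x).
  apply/cvgrPdist_lt => e e0.
  pose D := Lc * (n%:R + 1) + 1.
  have D0 : 0 < D by rewrite ltr_wpDl// mulr_ge0 ?addr_ge0.
  have [k ke] := ex_invS_lt _ _ (divr_gt0 e0 D0).
  exists k => // i /= ki; have [[Mui _] ui] := uP i.
  rewrite (le_lt_trans (mx_norm_le_enorm _ _ _))//.
  rewrite (le_lt_trans (c_lip _ _ _ _ Ml Mui Ax Ax))// subrr enorm0 addr0 enormB.
  rewrite (@le_lt_trans _ _ (D * k.+1%:R^-1))//; last by rewrite mulrC -ltr_pdivlMr.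
  have h : enorm (u i - l) <= (n%:R + 1) * k.+1%:R^-1.
    rewrite (le_trans (enorm_le_mx_norm _ _ _))// ler_wpM2l ?addr_ge0// (le_trans (ltW ui))//.
    by rewrite lef_pV2 ?posrE ?ltr0n// ler_nat ltnS.
  rewrite (le_trans (ler_wpM2l Lc0 h))// mulrA ler_wpM2r ?invr_ge0//.
  by rewrite lerDl.
apply: (@closed_cvg _ _ _ _ _ _ cl _ _ cu).
by exists 0%N => // k _; have [[]] := uP k.
Qed.

(* The set of the parameters reached by continuation along the segment from x
   to y is closed by compactness of M, and open by the local result, which
   holds with the same constant at every point of the level set. *)
Lemma level_set_continuation (L : R) (x y : 'rV[R]_m) (u : 'rV[R]_n) :
  0 <= L -> M u ->
  (forall s, 0 <= s <= 1 -> A (x + s *: (y - x))) ->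
  (forall s v, 0 <= s <= 1 -> M v ->
     c (row_mx v (x + s *: (y - x))) = c (row_mx u x) ->
     exists2 e, 0 < e & forall x', `|x' - (x + s *: (y - x))| < e ->
       exists v', [/\ M v',
         c (row_mx v' x') = c (row_mx v (x + s *: (y - x))) &
         enorm (v' - v) <= L * enorm (x' - (x + s *: (y - x)))]) ->
  exists v, [/\ M v, c (row_mx v y) = c (row_mx u x) &
    enorm (v - u) <= L * enorm (y - x)].
Proof.
move=> L0 Mu Axt local.
pose xt s := x + s *: (y - x).
have xtB s s' : xt s - xt s' = (s - s') *: (y - x).
  by apply/rowP => i; rewrite !mxE; ring.
pose D := enorm (y - x).
have D0 : 0 <= D by exact: enorm_ge0.
pose good s v := [/\ M v, c (row_mx v (xt s)) = c (row_mx u x) &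
  enorm (v - u) <= L * (s * D)].
pose G := [set s | 0 <= s <= 1 /\ exists v, good s v].
have G0 : G 0.
  split; first by rewrite lexx ler01.
  by exists u; split; rewrite ?/xt ?scale0r ?addr0// subrr enorm0 mul0r mulr0.
have Gub : has_ubound G by exists 1 => s [/andP[]].
have Gsup : has_sup G by split => //; exists 0.
pose T := sup G.
have T0 : 0 <= T by exact: ub_le_sup.
have T1 : T <= 1 by apply: ge_sup => [|s [/andP[]]//]; exists 0.
have T01 : 0 <= T <= 1 by rewrite T0.
have /choice[sv svP] : forall k : nat, exists sv : R * 'rV[R]_n,
    [/\ 0 <= sv.1 <= 1, T - k.+1%:R^-1 < sv.1, sv.1 <= T & good sv.1 sv.2].
  move=> k; have k0 : 0 < k.+1%:R^-1 :> R by rewrite invr_gt0.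
  have [s [s01 [v vP]] sT] := sup_adherent k0 Gsup.
  by exists (s, v); split => //; apply: ub_le_sup => //; split => //; exists v.
(* A limit point of the points reached at parameters tending to [T] shows that the supremum is
   attained. *)
have [|l [si [Ml ki lP]]] := @compact_subseq R 'rV[R]_n M (fun k => (sv k).2) compM.
  by move=> k; have [_ _ _ []] := svP k.
have Tl : good T l.
  have lclose k : enorm ((sv (si k)).2 - l) <= (n%:R + 1) * k.+1%:R^-1.
    by rewrite (le_trans (enorm_le_mx_norm _ _ _))// ler_wpM2l ?addr_ge0// ltW.
  split => //; last first.
    apply/ler_addgt0Pr => e e0.
    have n1 : 0 < n%:R + 1 :> R by rewrite ltr_wpDl.
    have [k ke] := ex_invS_lt _ _ (divr_gt0 e0 n1).
    have [_ _ sT [_ _ h]] := svP (si k).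
    rewrite (_ : l - u = ((sv (si k)).2 - u) - ((sv (si k)).2 - l)); last first.
      by apply/rowP => i; rewrite !mxE; ring.
    rewrite (le_trans (ler_enormD _ _ _ _))// enormN lerD//.
      by rewrite (le_trans h)// ler_wpM2l// ler_wpM2r.
    by rewrite (le_trans (lclose k))// mulrC -ler_pdivlMr// ltW.
  apply/eqP; rewrite -subr_eq0 -normr_le0 (le_trans (mx_norm_le_enorm _ _ _))//.
  apply/ler_addgt0Pr => e e0; rewrite add0r.
  pose B := Lc * (n%:R + 1 + D) + 1.
  have B0 : 0 < B by rewrite ltr_wpDl// mulr_ge0 ?addr_ge0.
  have [k ke] := ex_invS_lt _ _ (divr_gt0 e0 B0).
  have [s01 Ts sT [Mv <- _]] := svP (si k).
  rewrite (le_trans (c_lip _ _ _ _ Ml Mv (Axt _ T01) (Axt _ s01)))//.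
  have h1 : enorm (xt T - xt (sv (si k)).1) <= k.+1%:R^-1 * D.
    rewrite xtB enormZ ler_wpM2r// ger0_norm ?subr_ge0//.
    rewrite (@le_trans _ _ (si k).+1%:R^-1)//; first by rewrite lerBlDr -lerBlDl ltW.
    by rewrite lef_pV2 ?posrE ?ltr0n// ler_nat ltnS.
  rewrite (@le_trans _ _ (B * k.+1%:R^-1))//; last by rewrite mulrC -ler_pdivlMr// ltW.
  have h2 := lclose k; rewrite enormB in h2.
  rewrite (le_trans (ler_wpM2l Lc0 (lerD h2 h1)))//.
  rewrite (_ : Lc * _ = Lc * (n%:R + 1 + D) * k.+1%:R^-1); last by ring.
  by rewrite ler_wpM2r ?invr_ge0// lerDl.
have [Tlt1|T1le] := ltP T 1; last first.
  have TE : T = 1 by apply/eqP; rewrite eq_le T1.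
  move: Tl; rewrite TE /good /xt scale1r mul1r addrC subrK => -[? ? ?].
  by exists l.
exfalso.
have [_ cl lu] := Tl.
have [e e0 eP] := local T l T01 Ml cl.
(* A further step within the segment and within the reach of the local result at [T]; it produces a
   parameter beyond the supremum. *)
pose h := Num.min (1 - T) (e / 2 / (D + 1)).
have D1 : 0 < D + 1 by rewrite ltr_wpDl.
have h0 : 0 < h by rewrite lt_min subr_gt0 Tlt1 !divr_gt0.
have hT : h <= 1 - T by rewrite ge_min lexx.
have he : h * (D + 1) <= e / 2 by rewrite -ler_pdivlMr// ge_min lexx orbT.
have xh : xt (T + h) - xt T = h *: (y - x) by rewrite xtB addrC addKr.
have [|v [Mv cv vl]] := eP (xt (T + h)).
  rewrite -/(xt T) xh (le_lt_trans (mx_norm_le_enorm _ _ _))// enormZ gtr0_norm// -/D.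
  by move: he; rewrite mulrDr mulr1; lra.
have : T + h <= T.
  apply: ub_le_sup => //; split; first by apply/andP; split; lra.
  exists v; split => //; first by rewrite cv.
  rewrite (_ : v - u = (l - u) + (v - l)); last first.
    by apply/rowP => i; rewrite !mxE; ring.
  rewrite (le_trans (ler_enormD _ _ _ _))// mulrDl mulrDr lerD//.
  by rewrite (le_trans vl)// -/(xt T) xh enormZ gtr0_norm.
lra.
Qed.

End global.

(** The enlargements are defined by a strict inequality, so each [B + e] with [e > 0] is admissible
    rather than [B] itself. *)
Lemma hausdorff_dist_le (R : realType) (n : nat) (K1 K2 : set 'rV[R]_n) (B : R) :
  0 <= B ->
  (forall u, K1 u -> exists2 v, K2 v & enorm (u - v) <= B) ->
  (forall u, K2 u -> exists2 v, K1 v & enorm (u - v) <= B) ->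
  (hausdorff_dist K1 K2 <= B%:E)%E.
Proof.
move=> B0 H12 H21; apply/lee_addgt0Pr => e e0.
apply: ereal_inf_lbound; exists (B + e) => //.
have Be : 0 < B + e by rewrite ltr_wpDl.
split => // u Ku.
  have [v Kv uv] := H12 u Ku.
  rewrite /enlarge/= (@le_lt_trans _ _ (enorm (u - v))%:E)//.
    by apply: ereal_inf_lbound; exists v.
  by rewrite lte_fin (le_lt_trans uv)// ltrDl.
have [v Kv uv] := H21 u Ku.
rewrite /enlarge/= (@le_lt_trans _ _ (enorm (u - v))%:E)//.
  by apply: ereal_inf_lbound; exists v.
by rewrite lte_fin (le_lt_trans uv)// ltrDl.
Qed.

Theorem theorem3p2 (R : realType) :
  exists L : R -> R -> R -> R,
  forall (n d m j : nat) (M : set 'rV[R]_n) (atlas : set (chart R n d))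
    (C : set 'rV[R]_j) (X A : set 'rV[R]_m)
    (c : 'rV[R]_(n + m) -> 'rV[R]_j) (tau : R),
  is_lipschitz_manifold M atlas -> compact M -> (j <= d)%N ->
  convex_set X ->
  (forall x, X x -> U_set M C c x !=set0) ->
  X `<=` A -> open A ->
  lipschitz_cont (row_prod M A) c ->
  (forall x u, X x -> U_set M C c x u ->
     exists2 pi, multi_index pi & mx_set_invertible (E_set atlas A c u x pi)) ->
  (ereal_sup
     [set ereal_sup
            [set setnorm (mx_set_inv (E_set atlas A c xu.2 xu.1 pi)) |
               pi in Pi_set atlas A c xu.2 xu.1]
      | xu in [set xu : 'rV[R]_m * 'rV[R]_n |
                 X xu.1 /\ U_set M C c xu.1 xu.2]]
   < tau%:E)%E ->
  (closed C -> forall x, X x -> compact (U_set M C c x)) /\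
  (forall x y, X x -> X y ->
     (hausdorff_dist (U_set M C c x) (U_set M C c y)
      <= (L tau (Lip (row_prod M A) c) (LipM atlas) * enorm (x - y))%:E)%E).
Proof.
(* The constant of [local_level_set] for [t] equal to [|tau| + 1], which is positive for every real
   [tau] and bounds the norms of the inverses; no dimension enters. *)
exists (fun tau lc lm => lm * (2 * ((lc + 1) * (lm + 1)) / ((2 * (`|tau| + 1))^-1 / 4))).
move=> n d m j M atlas C X A c tau manM compM jd cvxX nonempty XA openA lipc regular supE.
split=> [cC x Xx|x y Xx Xy]; first exact: (compact_U_set _ _ _ _ _ _ _ compM lipc _ _ (XA _ Xx) cC).
set L := (L in L * _).
have tau0 : 0 < `|tau| + 1 by rewrite ltr_wpDl.
have Lc0 := Lip_ge0 _ _ _ _ _ lipc.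
have LM0 u : M u -> 0 <= LipM atlas.
  move=> Mu; have [chartP coverP _] := manM; have [psi Apsi _] := coverP u Mu.
  have [_ _ _ _ [l1 l2]] := chartP psi Apsi.
  apply: le_trans (Lip_chart_le_LipM _ _ _ _ _ _ manM compM Apsi).
  by rewrite addr_ge0 ?Lip_ge0.
have L0 : 0 <= L.
  have [u [Mu _]] := nonempty x Xx.
  have lm0 := LM0 u Mu.
  have d0 : 0 <= (2 * (`|tau| + 1))^-1 / 4 :> R.
    by apply: divr_ge0 => //; rewrite invr_ge0; apply: mulr_ge0 => //; exact: ltW.
  apply: mulr_ge0 => //; apply: divr_ge0 => //; apply: mulr_ge0 => //.
  by apply: mulr_ge0; exact: addr_ge0.
have step x' y' : X x' -> X y' -> forall u, U_set M C c x' u ->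
    exists2 v, U_set M C c y' v & enorm (u - v) <= L * enorm (x' - y').
  move=> Xx' Xy' u [Mu Cu].
  have Xt s : 0 <= s <= 1 -> X (x' + s *: (y' - x')).
    by move=> /andP[s0 s1]; have /convex_setP := cvxX; apply.
  have [|s v s01 Mv cv|v [Mv cv vu]] :=
      level_set_continuation _ _ _ _ _ _ _ compM lipc L x' y' u L0 Mu.
  - by move=> s /Xt /XA.
  (* A continued point keeps the value of [c], hence stays in the set [U] of the current parameter,
     where the regularity assumption and the bound by [tau] apply again. *)
  - have Uv : U_set M C c (x' + s *: (y' - x')) v by split => //; rewrite cv.
    have [pi pi_mi invE] := regular _ _ (Xt s s01) Uv.
    apply: (local_level_set _ _ _ _ _ _ _ _ _ manM compM openA lipc _ _ _ pi) => //.
      exact/XA/Xt.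
    move=> N EN.
    suff : ((opnorm (invmx N))%:E < tau%:E)%E.
      by rewrite lte_fin => /ltW/le_trans; apply; have := ler_norm tau; lra.
    apply: le_lt_trans supE.
    apply: (@le_trans _ _ (setnorm (mx_set_inv (E_set atlas A c v (x' + s *: (y' - x')) pi)))).
      by apply: ereal_sup_ubound; exists (invmx N) => //; exists N.
    apply: (@le_trans _ _ (ereal_sup
            [set setnorm (mx_set_inv (E_set atlas A c v (x' + s *: (y' - x')) pi)) |
               pi in Pi_set atlas A c v (x' + s *: (y' - x'))])).
      by apply: ereal_sup_ubound; exists pi.
    apply: ereal_sup_ubound; exists (x' + s *: (y' - x'), v) => //=.
    by split => //; exact: Xt.
  exists v; first by split => //; rewrite cv.
  by rewrite enormB (enormB _ _ x').
apply: hausdorff_dist_le; first by rewrite mulr_ge0 ?enorm_ge0.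
  exact: step.
by move=> u Uu; rewrite enormB; exact: step.
Qed.
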